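(* Let $Q=T[H_1,\dots,H_t]$ be a semicomplete composition, i.e. the composition of a semicomplete digraph $T$ with vertex set $\{u_1,\dots,u_t\}$ and digraphs $H_1,\dots,H_t$. For $i\in[t]$ let $l_i$ denote the maximum number of vertices of $H_i$ that can be covered by a longest path in $Q$, and let $m\in[t]$ be such that $l_m=\max\{l_i: i\in[t]\}$. If $H_m$ satisfies property BNY, then $Q$ satisfies property BNY as well.
   Context: Digraphs are finite, without loops and without parallel arcs (a pair of opposite arcs $xy,yx$ is allowed). All paths and cycles are directed, and a single vertex is a path of order 1. Write $[t]=\{1,\dots,t\}$. The order of a digraph is its number of vertices; $V(D)$ and $A(D)$ denote the vertex set and arc set of $D$. A longest path in $D$ is a path in $D$ of maximum order. Partition: a partition of a digraph $D$ is a pair $(A,B)$ of vertex-disjoint induced subdigraphs of $D$ with $V(A)\cup V(B)=V(D)$. Path parameters: $\lambda(D)$ is the maximum order of a path in $D$. A $k$-path subdigraph of $D$ is a collection of $k$ vertex-disjoint paths in $D$; its order is the total number of vertices on these paths. $\lambda_k(D)$ is the maximum order of a $k$-path subdigraph of $D$; thus $\lambda(D)=\lambda_1(D)$. Property BNY: a digraph $D$ satisfies BNY if for every integer $q$ with $1\le q\le\lambda(D)-1$ there is a partition $(A,B)$ of $D$ such that $\lambda(A)\le q$ and, for all $k\in\{1,2,\dots,|V(B)|\}$, $\lambda_k(B)\le\lambda_k(D)-q$. Composition: let $T$ be a digraph with vertex set $\{u_1,\dots,u_t\}$ and, for $i\in[t]$, let $H_i$ be a (nonempty) digraph with vertex set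 $\{u_{i,j_i}: j_i\in[n_i]\}$. The composition $Q=T[H_1,\dots,H_t]$ is the digraph with vertex set $\{u_{i,j_i}: i\in[t],\, j_i\in[n_i]\}$ and arc set $A(Q)=\bigcup_{i=1}^t A(H_i)\cup\{u_{i,j_i}u_{p,q_p}: u_iu_p\in A(T),\ j_i\in[n_i],\ q_p\in[n_p]\}$. A digraph is semicomplete if for every pair $x,y$ of distinct vertices there is at least one arc between $x$ and $y$. The composition is called semicomplete if $T$ is semicomplete. *)

(* Defs.v *)
From mathcomp Require Import all_boot.

Set Implicit Arguments.
Unset Strict Implicit.
Unset Printing Implicit Defensive.

Record digraph := Digraph {
  vertex :> finType;
  darc : rel vertex;
  darc_irr : irreflexive darc
}.

Definition semicomplete (D : digraph) : Prop :=
  forall x y : D, x != y -> darc x y || darc y x.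

Lemma induced_irr (D : digraph) (S : {set D}) :
  irreflexive (fun x y : {x : D | x \in S} => darc (val x) (val y)).
Proof. by move=> x; apply: darc_irr. Qed.

Definition induced (D : digraph) (S : {set D}) : digraph :=
  Digraph (induced_irr (S := S)).

Definition is_dipath (D : digraph) (p : seq D) : bool :=
  [&& p != [::], sorted (@darc D) p & uniq p].

(* A path repeats no vertex, so it has at most #|D| of them; bounded sequences
   carry all the paths of D and form a finite type to take maxima over. *)
Definition bpath (D : digraph) := {bseq #|D| of D}.

Definition lambda (D : digraph) : nat :=
  \max_(p : bpath D | is_dipath p) size p.

Definition kpath_vertices (D : digraph) (k : nat) (P : k.-tuple (bpath D)) :
  seq D := flatten [seq bseqval p | p <- P].

Definition is_kpath (D : digraph) (k : nat) (P : k.-tuple (bpath D)) : bool :=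
  all (fun p : bpath D => is_dipath p) P && uniq (kpath_vertices P).

(* For k > #|D| there is no k-path subdigraph and the value is 0. *)
Definition lambda_k (k : nat) (D : digraph) : nat :=
  \max_(P : k.-tuple (bpath D) | is_kpath P) size (kpath_vertices P).

Definition is_partition (D : digraph) (A B : {set D}) : Prop :=
  [disjoint A & B] /\ A :|: B = [set: D].

(* The bound on lambda_k B is written additively because subtraction on nat
   is truncated. *)
Definition BNY (D : digraph) : Prop :=
  forall q : nat, 1 <= q <= (lambda D).-1 ->
  exists A B : {set D},
    [/\ is_partition A B,
        lambda (induced A) <= q
      & forall k : nat, 1 <= k <= #|B| ->
          lambda_k k (induced B) + q <= lambda_k k D].

(* When tag x = tag y, tagged_as x y is tagged y transported to the type of
   tagged x. *)
Definition comp_arc (T : digraph) (H : T -> digraph) : rel {i : T & H i} :=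
  fun x y => (tag x == tag y) && darc (tagged x) (tagged_as x y)
             || darc (tag x) (tag y).

Lemma comp_arc_irr (T : digraph) (H : T -> digraph) :
  irreflexive (@comp_arc T H).
Proof. by case=> i x; rewrite /comp_arc tagged_asE !darc_irr andbF. Qed.

Definition composition (T : digraph) (H : T -> digraph) : digraph :=
  Digraph (@comp_arc_irr T H).

Definition is_longest_path (D : digraph) (p : seq D) : bool :=
  is_dipath p && (size p == lambda D).

(* The number l_i attached to the factor H i of the composition. *)
Definition max_cover (T : digraph) (H : T -> digraph) (i : T) : nat :=
  \max_(p : bpath (composition H) | is_longest_path p)
    #|[set x : composition H | (x \in bseqval p) && (tag x == i)]|.

(* Main.v *)
Require Import Defs.
From mathcomp Require Import all_boot zify.

(** Fix one factor of the composition and call its vertices a class.  Because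
    [T] is semicomplete, all vertices of a class have the same neighbours
    outside it, so for a path only the alternation counts between its runs
    inside the class and its excursions outside: the runs can be exchanged for
    any equally many other runs ([resegment]).  To treat [k] paths at once,
    [k] universal vertices, the hubs, are added to the digraph; at most [k]
    disjoint paths then become a single cycle through hubs, and a cycle that
    meets a class consists of equally many runs and excursions.

    The heart of the proof is [augment]: if there are two families of disjoint
    excursions and the second is larger, the first can be rearranged into a
    family with one more member that still covers everything it covered.  When
    an excursion cannot be split, it is a stretch of out-neighbours of the
    class followed by a stretch of vertices that are only in-neighbours; such a
    family is determined by the stretches and a matching between them, and the
    claim reduces to the fact that a bipartite matching extends to a larger one
    that still covers the vertices it covered ([exchange]).  One more excursion
    leaves room for one more run, so a family of paths can absorb new vertices
    of the class ([absorb]), or as many of them as some path of the digraph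
    covers ([absorb_class]).

    Write [n_i] and [lambda_i] for the order of the factor [H i] and of its
    longest path, [l_i] for [max_cover H i], and [Q] for the composition;
    inserting a longest path of [H i] into a longest path of [Q] shows that
    [lambda_i <= l_i].  Going through the indices by decreasing [n_i], but
    starting with [m], one collects greedily a set [I] that is transitive in [T].  An index [w] left
    out lies on a cycle of length 2 or 3 whose other indices belong to [I] and
    have factors at least as large as [H w] ([transitive_core]); if one of
    them is [m], the size comparison comes from [l_w <= l_m]
    ([cycle_factor_bound]).  A path inside the classes of [I] visits each of
    them at most once, so its order is at most the sum [S] of the [lambda_i]
    over [I].

    If [S <= q], let [A] be a maximal vertex set that contains the classes of
    [I] and spans no path of order more than [q].  By [absorb], every further
    vertex makes the longest path longer ([lambda_grows]); hence the complement
    [B] has at most [lambda Q - q] vertices, and this bounds every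
    [lambda_k B].

    If [q < S], choose [J] maximal in [I] without [m] such that the sum of the
    [lambda_j] over [J] is at most [q], and let [r] be the difference.  Then
    [r < l_m], since [lambda_j <= l_j <= l_m].  The set [A] consists of the
    classes of [J] and, inside [H m], of the part provided by [BNY (H m)] for
    [r] if [0 < r < lambda_m], and of all of [H m] if [lambda_m <= r].  Paths
    that avoid [A] are extended by a longest path of every [H j] with [j] in
    [J] ([insert_factors]), and then by [r] vertices of [H m]: by the defining
    inequality of [BNY] in the first case ([system_BNY_step]), and by
    [absorb_class], applied to a longest path that covers [l_m] vertices of
    [H m], in the second ([system_class_step]). *)

Set Implicit Arguments.
Unset Strict Implicit.
Unset Printing Implicit Defensive.

(** * Exchange between bipartite matchings *)

Lemma uniq_map_inj_in (A B : eqType) (f : A -> B) (s : seq A) :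
  uniq [seq f x | x <- s] -> {in s &, injective f}.
Proof.
elim: s => //= z s IH /andP[nz us] x y.
rewrite !inE => /predU1P[->|xs] /predU1P[->|ys] // E; last exact: IH.
  by rewrite E map_f in nz.
by rewrite -E map_f in nz.
Qed.

Lemma uniq_superset_cons (Z : eqType) (s s' : seq Z) :
  uniq s -> uniq s' -> {subset s <= s'} -> size s' = (size s).+1 ->
  exists x, perm_eq s' (x :: s).
Proof.
move=> us us' sub sz.
have p1 : perm_eq s [seq x <- s' | x \in s].
  apply: uniq_perm => //; first exact: filter_uniq.
  by move=> x; rewrite mem_filter; case xs: (x \in s); rewrite // sub.
have sz1 : size [seq x <- s' | x \notin s] = 1.
  have := size_filter (mem s) s'; have := size_filter (predC (mem s)) s'.
  have := count_predC (mem s) s'; have := perm_size p1 => /=.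
  by rewrite !size_filter; lia.
have [x E] : exists x, [seq x <- s' | x \notin s] = [:: x].
  by case: [seq _ <- _ | _] sz1 => // x [] // _; exists x.
exists x; rewrite -[x :: s]/([:: x] ++ s) -E perm_sym perm_catC.
by apply: perm_trans (permEl (perm_filterC (mem s) s')); rewrite perm_cat2r.
Qed.

Section Exchange.
Variables X Y : eqType.
Implicit Types M N : seq (X * Y).

Definition matching M := uniq (unzip1 M) && uniq (unzip2 M).

(** Among the matchings inside the union with one pair more than [M], one that
    shares as many pairs as possible with [M] covers all that [M] covers: a pair
    of [M] with an uncovered end conflicts with at most one pair of [N], and
    replacing that pair (or, without conflict, any pair outside [M]) increases
    the intersection. *)
Lemma exchange M N : matching M -> matching N -> size M < size N ->
  exists M' x y, [/\ matching M', {subset M' <= M ++ N},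
    perm_eq (unzip1 M') (x :: unzip1 M) & perm_eq (unzip2 M') (y :: unzip2 M)].
Proof.
move=> mM mN ltMN.
wlog sN : N mN ltMN / size N = (size M).+1.
  move=> wl; case: (wl (take (size M).+1 N)) => [|||M' [x [y [mM' s p1 p2]]]].
  - by rewrite /matching /unzip1 /unzip2 !map_take !take_uniq //; case/andP: mN.
  - by rewrite size_takel //; lia.
  - by rewrite size_takel //; lia.
  exists M', x, y; split=> // z /s; rewrite !mem_cat => /orP[->//|/mem_take ->].
  by rewrite orbT.
move: {2}(count (predC (mem M)) N) (leqnn (count (predC (mem M)) N)) => d.
elim: d N mN sN {ltMN} => [|d IH] N mN sN lecount.
  have /allP sub : all (mem M) N.
    rewrite -[all _ _]negbK -has_predC has_count; lia.
  have: size N <= size M.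
    by apply: uniq_leq_size => //; case/andP: mN => /map_uniq.
  lia.
case/andP: (mM) => uM1 uM2; case/andP: (mN) => uN1 uN2.
have uM : uniq M by apply: map_uniq uM1.
have uN : uniq N by apply: map_uniq uN1.
have step u v p : (u, v) \in M -> p \in N -> p \notin M ->
    u \notin unzip1 (rem p N) -> v \notin unzip2 (rem p N) ->
    exists M' x y, [/\ matching M', {subset M' <= M ++ N}, perm_eq (unzip1 M') (x :: unzip1 M)
      & perm_eq (unzip2 M') (y :: unzip2 M)].
  move=> uvM pN pM nu nv.
  case: (IH ((u, v) :: rem p N)).
  - rewrite /matching /= nu nv /=; apply/andP; split.
      by apply: subseq_uniq uN1; apply: map_subseq; apply: rem_subseq.
    by apply: subseq_uniq uN2; apply: map_subseq; apply: rem_subseq.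
  - by rewrite /= size_rem // sN.
  - have /permP/(_ (predC (mem M))) := perm_to_rem pN.
    by rewrite /= uvM pM add0n => E; move: lecount; rewrite E add1n ltnS.
  move=> M' [x' [y' [mM' s p1 p2]]]; exists M', x', y'; split=> // z /s.
  rewrite !mem_cat inE => /orP[->//|/orP[/eqP->|/mem_rem->]]; last by rewrite orbT.
  by rewrite uvM.
have /hasP[p0 p0N p0M] : has (predC (mem M)) N.
  rewrite has_predC; apply/negP => /allP sub.
  have: size N <= size M by apply: uniq_leq_size.
  lia.
have rem1 p u : p \in N -> u \in unzip1 (rem p N) -> u \in unzip1 N /\ u != p.1.
  move=> pN uin; have pm := perm_map fst (perm_to_rem pN); split.
    by rewrite (perm_mem pm) inE uin orbT.
  by apply: contraTneq uin => ->; move: uN1; rewrite /unzip1 (perm_uniq pm) /= => /andP[].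
have rem2 p u : p \in N -> u \in unzip2 (rem p N) -> u \in unzip2 N /\ u != p.2.
  move=> pN uin; have pm := perm_map snd (perm_to_rem pN); split.
    by rewrite (perm_mem pm) inE uin orbT.
  by apply: contraTneq uin => ->; move: uN2; rewrite /unzip2 (perm_uniq pm) /= => /andP[].
have conflict u v : (u, v) \in M -> (u \notin unzip1 N) || (v \notin unzip2 N) ->
    exists M' x y, [/\ matching M', {subset M' <= M ++ N}, perm_eq (unzip1 M') (x :: unzip1 M)
      & perm_eq (unzip2 M') (y :: unzip2 M)].
  move=> uvM nuv.
  have notM p : p \in N -> p.1 = u \/ p.2 = v -> p \notin M.
    move=> pN E; apply/negP => pM.
    have Ep : p = (u, v).
      by case: E => E; [apply: (uniq_map_inj_in uM1) | apply: (uniq_map_inj_in uM2)].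
    by move: nuv pN; rewrite Ep => /orP[/negP|/negP] n uvN; apply: n; apply/mapP; exists (u, v).
  have [uN1'|un] := boolP (u \in unzip1 N).
    have [p pN Eu] := mapP uN1'; rewrite uN1' /= in nuv.
    apply: (step u v p) => //; first by apply: notM => //; left.
      by apply/negP => /rem1 [//|_]; rewrite Eu eqxx.
    by apply: contra nuv => /rem2 [].
  have [vN2'|vn] := boolP (v \in unzip2 N).
    have [p pN Ev] := mapP vN2'.
    apply: (step u v p) => //; first by apply: notM => //; right.
      by apply: contra un => /rem1 [].
    by apply/negP => /rem2 [//|_]; rewrite Ev eqxx.
  apply: (step u v p0) => //; first by apply: contra un => /rem1 [].
  by apply: contra vn => /rem2 [].
have [/allP s1|/allPn[u uM' uN']] := boolP (all (mem (unzip1 N)) (unzip1 M)); last first.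
  have [[u' v] uvM /= eu] := mapP uM'; rewrite {}eu in uM' uN'.
  by apply: (conflict u' v) => //; rewrite uN'.
have [/allP s2|/allPn[v vM' vN']] := boolP (all (mem (unzip2 N)) (unzip2 M)); last first.
  have [[u v'] uvM /= ev] := mapP vM'; rewrite {}ev in vM' vN'.
  by apply: (conflict u v') => //; rewrite vN' orbT.
have [x px] : exists x, perm_eq (unzip1 N) (x :: unzip1 M).
  by apply: uniq_superset_cons => //; rewrite !size_map.
have [y py] : exists y, perm_eq (unzip2 N) (y :: unzip2 M).
  by apply: uniq_superset_cons => //; rewrite !size_map.
by exists N, x, y; split=> // z zN; rewrite mem_cat zN orbT.
Qed.
End Exchange.

(** * Excursions outside a class *)

Lemma flatten_map_cat (A B : eqType) (f g : A -> seq B) (s : seq A) :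
  perm_eq (flatten [seq f x ++ g x | x <- s])
          (flatten [seq f x | x <- s] ++ flatten [seq g x | x <- s]).
Proof.
elim: s => //= x s IH.
by rewrite -!catA perm_cat2l perm_sym perm_catCA perm_cat2l perm_sym.
Qed.

Section Excursions.
Variables (T D : eqType) (t : rel T) (e : rel D) (c : D -> T).
Hypothesis t_irr : irreflexive t.
Hypothesis t_semi : forall i j, i != j -> t i j || t j i.
Hypothesis t_e : forall u v, t (c u) (c v) -> e u v.
Hypothesis e_t : forall u v, e u v -> c u != c v -> t (c u) (c v).
Variable w : T.
Implicit Types (x y v : D) (f g h l : seq D) (F G : seq (seq D)).

Definition out v := t w (c v).
Definition inn v := t (c v) w.
Definition off v := c v != w.
(** The paths that can be inserted between two runs inside class [w]: by
    [t_e], only the classes of the two end vertices matter. *)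
Definition excursion f :=
  if f is x :: f' then [&& path e x f', out x, inn (last x f') & all off f]
  else false.

Lemma out_off v : out v -> off v.
Proof. by rewrite /out /off; apply: contraTneq => ->; rewrite t_irr. Qed.

Lemma inn_off v : inn v -> off v.
Proof. by rewrite /inn /off; apply: contraTneq => ->; rewrite t_irr. Qed.

Lemma off_inn v : off v -> ~~ out v -> inn v.
Proof. by rewrite /off eq_sym /out /inn => /t_semi /orP[->|]. Qed.

Lemma out_arc x y : e x y -> out x -> ~~ out y -> t (c x) (c y).
Proof.
move=> exy ox noy; apply: e_t => //.
by apply: contraNneq noy; rewrite /out => <-.
Qed.

Lemma excursion_off f : excursion f -> all off f.
Proof. by case: f => // x f /and4P[]. Qed.

Definition ionly v := inn v && ~~ out v.

(** Where an in-neighbour of the class is followed by an out-neighbour, a run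
    of the class could be inserted.  Without such a gap, once a vertex is not an
    out-neighbour no later vertex is one. *)
Lemma monotone_or_gap f : all off f ->
  (exists f1 a b f2, [/\ f = rcons f1 a ++ b :: f2, inn a & out b]) \/
  (exists o i, [/\ f = o ++ i, all out o & all ionly i]).
Proof.
elim: f => [|v f IH] /=; first by right; exists [::], [::].
case/andP=> ov /IH [[f1 [a [b [f2 [-> ia ob]]]]]|[o [i [-> oo ii]]]].
  by left; exists (v :: f1), a, b, f2.
have [vo|vno] := boolP (out v).
  by right; exists (v :: o), i; split=> //=; rewrite vo.
case: o oo => [|b o] /= oo.
  by right; exists [::], (v :: i); split=> //=; rewrite ii /ionly off_inn // vno.
by left; exists [::], v, b, (o ++ i); case/andP: oo => bo _; split=> //; apply: off_inn.
Qed.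

(** The pairs at which an unsplittable excursion turns back to the class.  A
    vertex that is both an in- and an out-neighbour is an excursion by itself
    and is linked with itself only, so that in a matching of links the two roles
    of a vertex never conflict. *)
Definition link x y :=
  [&& out x, inn y & if inn x then x == y else ~~ out y && t (c x) (c y)].

(** [hd_ok x h] says that [h] can be the part of an excursion that ends at the
    first vertex [x] of a link, and [tl_ok y l] that [l] can be the rest when
    the second vertex is [y]; if [y] is an out-neighbour then [y = x], and it
    already belongs to the first part. *)
Definition hd_ok x h := exists2 o, h = rcons o x & sorted e h && all out h.
Definition tl_ok y l :=
  exists2 s, l = (if out y then s else y :: s) & path e y s && all ionly s.

Lemma link_out x y : link x y -> out y -> x = y.
Proof.
by case/and3P=> _ _; case: ifP => [_ /eqP //|_ /andP[/negPf->]].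
Qed.

Lemma ionly_off s : all ionly s -> all off s.
Proof. by apply: sub_all => v /andP[/inn_off]. Qed.

Lemma all_out_off s : all out s -> all off s.
Proof. by apply: sub_all => v; apply: out_off. Qed.

Lemma last_ionly y s : inn y -> all ionly s -> inn (last y s).
Proof.
move=> iy; elim/last_ind: s => // s z _; rewrite all_rcons last_rcons.
by case/andP=> /andP[].
Qed.

Lemma excursion_glue x y h l : link x y -> hd_ok x h -> tl_ok y l ->
  excursion (h ++ l).
Proof.
move=> lxy [o Eh /andP[sh oh]] [s El /andP[ps si]].
have [ox iy cxy] := and3P lxy.
have yl : inn (last y s) by apply: last_ionly.
have offl : all off l.
  rewrite El; case: ifP => _ /=; rewrite ionly_off // andbT; exact: inn_off.
have offh := all_out_off oh.
have pl : path e x l /\ inn (last x l).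
  rewrite El; case: ifP => oy; first by rewrite (link_out lxy oy).
  move: cxy; case: ifP => [_ /eqP xy|_ /andP[_ txy]] /=.
    by move: oy; rewrite -xy ox.
  by rewrite t_e.
case: pl => pl ll.
case: o Eh => [|z o] Eh; rewrite Eh in sh oh offh *.
  by rewrite /= pl ox ll out_off.
move: sh oh offh => /= sh /andP[oz _] offh.
case/andP: offh => offz offh.
by rewrite cat_path last_cat last_rcons sh pl oz ll all_cat offl offz offh.
Qed.

Lemma excursion_nf f : excursion f ->
  (exists f1 f2, [/\ f = f1 ++ f2, excursion f1 & excursion f2]) \/
  (exists x y h l, [/\ f = h ++ l, link x y, hd_ok x h & tl_ok y l]).
Proof.
case: f => // z f exf; have /and4P[pf oz lf offf] := exf.
have [[f1 [a [b [f2 [Ef ia ob]]]]]|[o [i [Ef oo ii]]]] := monotone_or_gap offf.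
  left; exists (rcons f1 a), (b :: f2); split=> //; move: exf; rewrite Ef.
    case: f1 {Ef} => [|z1 f1] /=; first by rewrite ia andbT => /and4P[_ -> _ /andP[->]].
    rewrite cat_path all_cat last_rcons ia /=.
    by move=> /and4P[/andP[-> _] -> _ /andP[-> /andP[-> _]]].
  rewrite /= ob; case: f1 {Ef} => [|z1 f1] /=.
    by move=> /and4P[/andP[_ ->] _ -> /andP[_ ->]].
  rewrite cat_path all_cat last_cat /=.
  by move=> /and4P[/andP[_ /andP[_ ->]] _ -> /andP[_ /andP[_ ->]]].
right; elim/last_ind: o oo Ef => [|o x _] oo Ef.
  by move: ii; rewrite -[i]/([::] ++ i) -Ef /= /ionly oz andbF.
have sf : sorted e (rcons o x ++ i) by rewrite -Ef.
have lx : inn (last x i) by move: lf; case: o {oo sf} Ef => [|z1 o] [-> ->] //; rewrite last_cat last_rcons.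
have ox : out x by move: oo; rewrite all_rcons => /andP[].
have so : sorted e (rcons o x).
  by move: sf; case: o {oo Ef} => //= z1 o; rewrite cat_path => /andP[].
have pi : path e x i.
  by move: sf; case: o {oo Ef so} => //= z1 o; rewrite cat_path last_rcons => /andP[].
have hdx : hd_ok x (rcons o x) by exists o; rewrite // so oo.
have [ix|nix] := boolP (inn x).
  exists x, x, (rcons o x), i; split=> //; first by rewrite /link ox ix eqxx.
  by exists i; rewrite ?ox // pi ii.
case: i {sf} Ef ii lx pi => [|y i] /=; first by rewrite (negPf nix).
move=> Ef /andP[/andP[iy noy] ii] lx /andP[exy pi].
exists x, y, (rcons o x), (y :: i); split=> //.
  by rewrite /link ox iy (negPf nix) noy out_arc.
by exists i; rewrite ?(negPf noy) // pi ii.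
Qed.

Lemma excursion_link f : excursion f -> exists x y, [/\ link x y, x \in f & y \in f].
Proof.
case: f => // x f /and4P[pf ox lf /= /andP[_ offf]].
elim: f x pf ox lf offf => [|y f IH] x /=.
  by move=> _ ox ix _; exists x, x; rewrite /link ox ix eqxx inE eqxx.
case/andP=> exy pf ox lf /andP[offy offf].
have [ix|nix] := boolP (inn x).
  by exists x, x; rewrite /link ox ix eqxx inE eqxx.
have [oy|noy] := boolP (out y).
  have [x' [y' [lxy xf yf]]] := IH y pf oy lf offf.
  by exists x', y'; split=> //; rewrite inE ?xf ?yf orbT.
exists x, y; rewrite /link ox (negPf nix) noy off_inn // out_arc //.
by rewrite !inE !eqxx !orbT.
Qed.

Lemma links_of G : all excursion G -> uniq (flatten G) ->
  exists N, [/\ size N = size G, matching N, all (fun p => link p.1 p.2) N,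
     {subset unzip1 N <= flatten G} & {subset unzip2 N <= flatten G}].
Proof.
elim: G => [|g G IH] /=; first by exists [::].
case/andP=> /excursion_link [x [y [lxy xg yg]]] /IH {}IH.
rewrite cat_uniq => /and3P[_ /hasPn dis /IH [N [sN /andP[m1 m2] lN s1 s2]]].
exists ((x, y) :: N); split=> /=; rewrite ?sN ?lxy //.
- rewrite /matching /= m1 m2 !andbT; apply/andP; split.
    by apply: contraL xg => /s1 /dis.
  by apply: contraL yg => /s2 /dis.
- by move=> z; rewrite inE mem_cat => /predU1P[->|/s1->]; rewrite ?xg ?orbT.
- by move=> z; rewrite inE mem_cat => /predU1P[->|/s2->]; rewrite ?yg ?orbT.
Qed.

Lemma normalize F : all excursion F -> uniq (flatten F) ->
  (exists F', [/\ size F' = (size F).+1, all excursion F'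
    & perm_eq (flatten F') (flatten F)]) \/
  (exists M hd tl, [/\ F = [seq hd p.1 ++ tl p.2 | p : D * D <- M], matching M,
     all (fun p => link p.1 p.2) M,
     forall x, x \in unzip1 M -> hd_ok x (hd x) &
     forall y, y \in unzip2 M -> tl_ok y (tl y)]).
Proof.
elim: F => [|f F IH] /=; first by right; exists [::], (fun=> [::]), (fun=> [::]).
case/andP=> exf exF; rewrite cat_uniq => /and3P[_ /hasPn dis uF].
have [[F' [sF' exF' pF']]|[M [hd [tl [EF /andP[m1 m2] lM hdM tlM]]]]] := IH exF uF.
  by left; exists (f :: F'); rewrite /= sF' exf exF' perm_cat2l.
have [[f1 [f2 [-> ex1 ex2]]]|[x [y [h [l [Ef lxy hdx tly]]]]]] := excursion_nf exf.
  by left; exists (f1 :: f2 :: F); rewrite /= ex1 ex2 exF catA.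
have xf : x \in f by rewrite Ef mem_cat; case: hdx => o -> _; rewrite mem_rcons inE eqxx.
have yf : y \in f.
  have [oy|noy] := boolP (out y); first by rewrite -(link_out lxy oy).
  by rewrite Ef mem_cat; case: tly => s ->; rewrite (negPf noy) inE eqxx orbT.
have FM z : z \in flatten F -> z \notin f by move/dis.
have subM1 : {subset unzip1 M <= flatten F}.
  move=> z zM; have [p pM Ez] := mapP zM.
  rewrite EF; apply/flattenP; exists (hd p.1 ++ tl p.2); first by apply: (map_f (fun p => hd p.1 ++ tl p.2)).
  by have [o Eh _] := hdM z zM; rewrite -Ez Eh mem_cat mem_rcons inE eqxx.
have subM2 : {subset unzip2 M <= flatten F}.
  move=> z zM; have [p pM Ez] := mapP zM.
  have [oz|noz] := boolP (out z).
    have /= lp := allP lM p pM; rewrite -Ez in lp.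
    by rewrite -(link_out lp oz); apply: subM1; apply: map_f.
  rewrite EF; apply/flattenP; exists (hd p.1 ++ tl p.2); first by apply: (map_f (fun p => hd p.1 ++ tl p.2)).
  by have [s El _] := tlM z zM; rewrite -Ez El (negPf noz) mem_cat inE eqxx orbT.
have nx z : z \in unzip1 M -> (z == x) = false.
  by move=> /subM1 /FM zf; apply: contraNF zf => /eqP->.
have ny z : z \in unzip2 M -> (z == y) = false.
  by move=> /subM2 /FM zf; apply: contraNF zf => /eqP->.
right; exists ((x, y) :: M), (fun z => if z == x then h else hd z),
  (fun z => if z == y then l else tl z); split=> /=.
- rewrite !eqxx -Ef EF; congr cons; apply/eq_in_map => p pM.
  by rewrite nx ?ny //; apply: map_f.
- rewrite /matching /= m1 m2 !andbT; apply/andP; split.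
    by apply/negP => /nx; rewrite eqxx.
  by apply/negP => /ny; rewrite eqxx.
- by rewrite lxy.
- by move=> z; rewrite inE; case: ifP => [/eqP->//|_] /= /hdM.
- by move=> z; rewrite inE; case: ifP => [/eqP->//|_] /= /tlM.
Qed.

(** Makes [a] the key of a piece of its own.  If [a] already lies on the piece
    of some key [x], that piece is cut into a piece for [a] and a shorter one
    for [x], so that no vertex is lost. *)
Lemma recut (ok : D -> seq D -> Prop) (piece : D -> seq D) a xs :
  ok a [:: a] ->
  (forall x l, x != a -> ok x l -> a \in l ->
     exists l1 l2, [/\ perm_eq l (l1 ++ l2), ok a l1 & ok x l2]) ->
  uniq xs -> a \notin xs ->
  (forall x, x \in xs -> ok x (piece x)) -> uniq (flatten (map piece xs)) ->
  exists piece', [/\ forall x, x \in a :: xs -> ok x (piece' x),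
    uniq (flatten (map piece' (a :: xs))),
    {subset flatten (map piece xs) <= flatten (map piece' (a :: xs))} &
    {subset flatten (map piece' (a :: xs)) <= a :: flatten (map piece xs)}].
Proof.
move=> ok_a ok_cut uxs axs okxs upieces.
have [ain|anin] := boolP (a \in flatten (map piece xs)); last first.
  have E : [seq (if z == a then [:: a] else piece z) | z <- xs] = map piece xs.
    by apply/eq_in_map => z zxs; case: eqP => // za; rewrite -za zxs in axs.
  exists (fun z => if z == a then [:: a] else piece z); rewrite /= E eqxx; split=> //=.
  - by move=> z; rewrite inE; case: eqP => [->|_] //= /okxs.
  - by rewrite anin.
  - by move=> z zin; rewrite inE zin orbT.
have [x xxs apx] := flatten_mapP ain.
have xa : x != a by apply: contraNneq axs => <-.
have [l1 [l2 [pl ok1 ok2]]] := ok_cut x _ xa (okxs x xxs) apx.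
pose piece' z := if z == a then l1 else if z == x then l2 else piece z.
have pm : perm_eq (flatten (map piece' (a :: xs))) (flatten (map piece xs)).
  have px := perm_to_rem xxs.
  have := perm_flatten (perm_map piece px).
  have := perm_flatten (perm_map piece' px).
  rewrite /= /piece' eqxx (negPf xa) eqxx -/piece'.
  have -> : map piece' (rem x xs) = map piece (rem x xs).
    apply/eq_in_map => z; rewrite mem_rem_uniq // !inE /piece' => /andP[/negPf-> zxs].
    by case: eqP => // za; rewrite -za zxs in axs.
  move=> p1 p2; apply: perm_trans (_ : perm_eq _ ((l1 ++ l2) ++ flatten (map piece (rem x xs)))) _.
    by rewrite -catA perm_cat2l.
  by rewrite perm_sym; apply: perm_trans p2 _; rewrite perm_cat2r.
exists piece'; split.
- move=> z; rewrite inE /piece'; case: eqP => [->//|_] /=.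
  by case: eqP => [->//|_]; apply: okxs.
- by rewrite (perm_uniq pm).
- by move=> z; rewrite (perm_mem pm).
- by move=> z; rewrite (perm_mem pm) inE => ->; rewrite orbT.
Qed.

Lemma hd_cut a x h : x != a -> hd_ok x h -> a \in h ->
  exists l1 l2, [/\ perm_eq h (l1 ++ l2), hd_ok a l1 & hd_ok x l2].
Proof.
move=> xa [o Eh /andP[sh oh]] ah.
case/splitPr: ah Eh sh oh => h1 h2; elim/last_ind: h2 => [|h2 z _].
  by rewrite cats1 => /rcons_inj[_ ax]; rewrite ax eqxx in xa.
rewrite -rcons_cons -rcons_cat => /rcons_inj[_ ->]; rewrite rcons_cat rcons_cons -cat_rcons.
rewrite all_cat => sh /andP[o1 o2].
exists (rcons h1 a), (rcons h2 x); split=> //.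
  exists h1; rewrite // o1 andbT.
  by case: h1 sh {o1} => //= b h1; rewrite cat_path => /andP[].
exists h2; rewrite // o2 andbT.
move: sh; case: h1 {o1} => [|b h1] /= => [/path_sorted//|].
by rewrite cat_path => /andP[_ /path_sorted].
Qed.

Lemma tl_cut a y l : ionly a -> y != a -> tl_ok y l -> a \in l ->
  exists l1 l2, [/\ perm_eq l (l1 ++ l2), tl_ok a l1 & tl_ok y l2].
Proof.
move=> /andP[_ /negPf noa] ya [s El /andP[ps si]] al.
have {al} as_ : a \in s.
  by move: al; rewrite El; case: ifP => // _; rewrite inE eq_sym (negPf ya).
case/splitPr: as_ El ps si => s1 s2 El.
rewrite cat_path all_cat /= => /andP[p1 /andP[_ p2]] /and3P[i1 ia i2].
exists (a :: s2), (if out y then s1 else y :: s1); split.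
- rewrite El perm_sym; case: ifP => _; first by rewrite perm_catC.
  by rewrite -cat_cons perm_catC.
- by exists s2; rewrite ?noa // p2 i2.
- by exists s1; rewrite // p1 i1.
Qed.

(** If a member of [F] splits, splitting it is enough.  Otherwise [F] is a
    matching of links between first parts and second parts.  An uncovered vertex
    that is both an in- and an out-neighbour gives a new excursion; without one,
    [exchange] gives a larger matching of links with only one new first vertex
    and one new second vertex.  Cutting the parts at these two vertices and
    joining them along the new matching gives the family. *)
Lemma augment F G : all excursion F -> all excursion G ->
  uniq (flatten F) -> uniq (flatten G) -> size F < size G ->
  exists F', [/\ size F' = (size F).+1, all excursion F', uniq (flatten F'),
    {subset flatten F <= flatten F'} &
    {subset flatten F' <= flatten F ++ flatten G}].
Proof.
move=> exF exG uF uG ltFG.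
have [[F' [sF' exF' pF']]|[M [hd [tl [EF mM lM hdM tlM]]]]] := normalize exF uF.
  exists F'; split=> //; rewrite ?(perm_uniq pF') //.
    by move=> z; rewrite (perm_mem pF').
  by move=> z; rewrite (perm_mem pF') mem_cat => ->.
have pF : perm_eq (flatten F) (flatten (map hd (unzip1 M)) ++ flatten (map tl (unzip2 M))).
  by rewrite EF /unzip1 /unzip2 -!map_comp; apply: flatten_map_cat.
have [um1 um2] := andP mM.
have memF := perm_mem pF.
move: (uF); rewrite (perm_uniq pF) cat_uniq => /and3P[uhd _ utl].
have hdout z xs hd0 : (forall x, x \in xs -> hd_ok x (hd0 x)) ->
    z \in flatten (map hd0 xs) -> out z.
  by move=> hok /flatten_mapP[x xM]; have [o -> /andP[_ /allP]] := hok x xM; apply.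
have tlnout z ys tl0 : (forall y, y \in ys -> tl_ok y (tl0 y)) ->
    z \in flatten (map tl0 ys) -> ~~ out z.
  move=> tok /flatten_mapP[y yM]; have [s -> /andP[_ /allP si]] := tok y yM.
  case: ifPn => [_ /si /andP[] //|no]; rewrite inE => /predU1P[->//|/si /andP[] //].
have hd_base a : out a -> hd_ok a [:: a] by exists [::]; rewrite //= H.
have excM (M0 : seq (D * D)) hd0 tl0 : all (fun p => link p.1 p.2) M0 ->
    (forall x, x \in unzip1 M0 -> hd_ok x (hd0 x)) ->
    (forall y, y \in unzip2 M0 -> tl_ok y (tl0 y)) ->
    all excursion [seq hd0 p.1 ++ tl0 p.2 | p <- M0].
  move=> /allP lM0 hok tok; apply/allP => _ /mapP[p pM ->].
  apply: (excursion_glue (lM0 p pM)); first by apply: hok; apply: map_f.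
  by apply: tok; apply: map_f.
have [/hasP[n ncover /and3P[on inn_n nM]]|] :=
  boolP (has (fun n => [&& out n, inn n & n \notin unzip1 M]) (flatten F ++ flatten G)).
  have [hd' [hok u' sub1 sub2]] := recut (hd_base n on) (@hd_cut n) um1 nM hdM uhd.
  have okM x : x \in unzip1 M -> hd_ok x (hd' x) by move=> xM; apply: hok; rewrite inE xM orbT.
  set F1 := [seq hd' p.1 ++ tl p.2 | p <- M].
  have pF1 : perm_eq (flatten (hd' n :: F1)) (flatten (map hd' (n :: unzip1 M)) ++ flatten (map tl (unzip2 M))).
    by rewrite /= -catA perm_cat2l /unzip1 /unzip2 -!map_comp; apply: flatten_map_cat.
  exists (hd' n :: F1); split.
  - by rewrite /= EF !size_map.
  - rewrite /= excM // andbT -[hd' n]cats0; apply: (@excursion_glue n n).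
    + by rewrite /link on inn_n eqxx.
    + by apply: hok; rewrite inE eqxx.
    + by exists [::]; rewrite ?on.
  - rewrite (perm_uniq pF1) cat_uniq u' utl andbT /=; apply/hasPn => z zt.
    by apply/negP => /(hdout z _ _ hok) oz; move: (tlnout z _ _ tlM zt); rewrite oz.
  - move=> z; rewrite memF (perm_mem pF1) mem_cat => zF; rewrite mem_cat; case/orP: zF => [/sub1->//|->].
    by rewrite orbT.
  - move=> z; rewrite (perm_mem pF1) mem_cat => /orP[/sub2|zt]; last first.
      by rewrite mem_cat memF mem_cat zt orbT.
    by rewrite inE => /predU1P[->//|zh]; rewrite mem_cat memF mem_cat zh.
rewrite -all_predC => /allP noN.
have [N [sN mN lN sub1 sub2]] := links_of exG uG.
have [|M' [x0 [y0 [mM' sM' p1 p2]]]] := exchange mM mN.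
  by rewrite sN; move: ltFG; rewrite EF size_map.
have lM' : all (fun p => link p.1 p.2) M'.
  by apply/allP => p /sM'; rewrite mem_cat => /orP[/(allP lM)|/(allP lN)].
have hdF z : z \in unzip1 M -> z \in flatten F.
  move=> zM; rewrite memF mem_cat; apply/orP; left; apply/flatten_mapP; exists z => //.
  by have [o -> _] := hdM z zM; rewrite mem_rcons inE eqxx.
have tlF z : z \in unzip2 M -> z \in flatten F.
  move=> zM; have [oz|noz] := boolP (out z).
    have [p pM Ez] := mapP zM; have lp := allP lM p pM; rewrite -Ez in lp.
    by rewrite -(link_out lp oz); apply: hdF; apply: map_f.
  rewrite memF mem_cat; apply/orP; right; apply/flatten_mapP; exists z => //.
  by have [s -> _] := tlM z zM; rewrite (negPf noz) inE eqxx.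
have x0M' : x0 \in unzip1 M' by rewrite (perm_mem p1) inE eqxx.
have y0M' : y0 \in unzip2 M' by rewrite (perm_mem p2) inE eqxx.
case/andP: mM'; rewrite (perm_uniq p1) (perm_uniq p2) => /andP[x0M _] /andP[y0M _].
have cov p : p \in M' -> p.1 \in flatten F ++ flatten G /\ p.2 \in flatten F ++ flatten G.
  move=> /sM'; rewrite !mem_cat => /orP[] pM.
    by rewrite hdF ?tlF //; apply: map_f.
  by rewrite sub1 ?sub2 ?orbT //; apply: map_f.
have ox0 : out x0 by have [p pM ->] := mapP x0M'; have /and3P[] := allP lM' p pM.
have iy0 : ionly y0.
  have [p pM Ey] := mapP y0M'; have lp := allP lM' p pM; rewrite -Ey in lp.
  have /and3P[_ iy _] := lp; rewrite /ionly iy /=; apply/negP => oy.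
  have y0c : y0 \in flatten F ++ flatten G by rewrite Ey; case: (cov p pM).
  have y0s : y0 \in unzip1 M.
    by apply: contraT => y0n; case/negP: (noN y0 y0c); apply/and3P.
  have [q qM Eq] := mapP y0s; have /and3P[_ _] := allP lM q qM; rewrite -Eq iy => /eqP Eq2.
  by move: y0M; rewrite Eq2 map_f.
(* The new first vertex x0 and second vertex y0 become keys of parts of their own. *)
have [hd' [hok u1 s1 s1']] := recut (hd_base x0 ox0) (@hd_cut x0) um1 x0M hdM uhd.
have tl_base : tl_ok y0 [:: y0] by exists [::] => //; case/andP: (iy0) => _ /negPf->.
have [tl' [tok u2 s2 s2']] := recut tl_base (fun x l => @tl_cut y0 x l iy0) um2 y0M tlM utl.
have pF' : perm_eq (flatten [seq hd' p.1 ++ tl' p.2 | p <- M'])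
   (flatten (map hd' (x0 :: unzip1 M)) ++ flatten (map tl' (y0 :: unzip2 M))).
  apply: perm_trans (flatten_map_cat _ _ _) _.
  rewrite (map_comp hd' fst) (map_comp tl' snd); apply: perm_cat; apply: perm_flatten; exact: perm_map.
exists [seq hd' p.1 ++ tl' p.2 | p <- M']; split.
- by rewrite size_map -(size_map fst) (perm_size p1) /= EF !size_map.
- apply: excM => // z; first by rewrite (perm_mem p1); apply: hok.
  by rewrite (perm_mem p2); apply: tok.
- rewrite (perm_uniq pF') cat_uniq u1 u2 andbT /=; apply/hasPn => z zt.
  by apply/negP => /(hdout z _ _ hok) oz; move: (tlnout z _ _ tok zt); rewrite oz.
- move=> z; rewrite memF (perm_mem pF') mem_cat => zF; rewrite mem_cat.
  by case/orP: zF => [/s1->|/s2->]; rewrite ?orbT.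
- have x0c : x0 \in flatten F ++ flatten G.
    by have [p pM ->] := mapP x0M'; case: (cov p pM).
  have y0c : y0 \in flatten F ++ flatten G.
    by have [p pM ->] := mapP y0M'; case: (cov p pM).
  move=> z; rewrite (perm_mem pF') mem_cat => /orP[/s1'|/s2']; rewrite inE => /predU1P[->//|zin].
    by rewrite mem_cat memF mem_cat zin.
  by rewrite mem_cat memF mem_cat zin orbT.
Qed.

Lemma augment_to F G n : all excursion F -> all excursion G ->
  uniq (flatten F) -> uniq (flatten G) -> size F <= n <= size G ->
  exists F', [/\ size F' = n, all excursion F', uniq (flatten F'),
    {subset flatten F <= flatten F'} &
    {subset flatten F' <= flatten F ++ flatten G}].
Proof.
move=> exF exG uF uG /andP[leFn lenG].
have -> : n = (n - size F) + size F by lia.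
have : (n - size F) + size F <= size G by lia.
elim: (n - size F) => [_|d IH ltdG].
  by exists F; split=> // v vF; rewrite mem_cat vF.
have [|F1 [sF1 exF1 uF1 sub1 sub2]] := IH; first exact: ltnW.
have [|F2 [sF2 exF2 uF2 sub3 sub4]] := augment exF1 exG uF1 uG.
  by rewrite sF1.
exists F2; split=> //; first by rewrite sF2 sF1.
  by move=> v /sub1 /sub3.
by move=> v /sub4; rewrite mem_cat => /orP[/sub2//|vG]; rewrite mem_cat vG orbT.
Qed.

Definition run u := [&& u != [::], sorted e u & all (fun v => c v == w) u].

Definition weave U F := flatten [seq p.1 ++ p.2 | p <- zip U F].

Lemma perm_weave U F : size U = size F ->
  perm_eq (weave U F) (flatten U ++ flatten F).
Proof.
move=> sUF; apply: perm_trans (flatten_map_cat _ _ _) _.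
by rewrite -/(unzip1 _) -/(unzip2 _) unzip1_zip ?unzip2_zip ?sUF.
Qed.

Lemma weave_path U F : size U = size F -> U != [::] -> all run U ->
  all excursion F -> exists x p,
  [/\ weave U F = x :: p, c x = w, inn (last x p) & path e x p].
Proof.
elim: U F => [|u U IH] [|f F] //= [sUF] _ /andP[/and3P[u0 su cu] rU] /andP[exf exF].
rewrite /weave /=; case: u u0 su cu => // x u _ /= pu /andP[/eqP cx /allP cu].
case: f exf => // y f /and4P[pf oy lf _].
have wlast : c (last x u) = w.
  by have := mem_last x u; rewrite inE => /predU1P[->//|/cu/eqP].
have path1 : path e x (u ++ y :: f).
  by rewrite cat_path pu /= pf t_e // wlast.
have last1 : last x (u ++ y :: f) = last y f by rewrite last_cat.
case: U IH sUF rU => [|u2 U] IH sUF rU.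
  case: F sUF {exF} => // _; exists x, (u ++ y :: f).
  by rewrite /= cats0 last1.
have [x2 [p2 [E cx2 l2 p2P]]] := IH F sUF isT rU exF.
rewrite /weave in E; rewrite E; exists x, ((u ++ y :: f) ++ x2 :: p2); split=> //.
  by rewrite last_cat.
by rewrite cat_path path1 last1 /= p2P t_e // cx2.
Qed.

Lemma weave_cycle U F : size U = size F -> all run U -> all excursion F ->
  cycle e (weave U F).
Proof.
case: (eqVneq U [::]) => [->|U0] sUF rU exF; first by case: F sUF exF.
have [x [p [-> cx lx px]]] := weave_path sUF U0 rU exF.
by rewrite /cycle rcons_path px t_e // cx.
Qed.

Definition okin b := if b is x :: b' then inn (last x b') else true.
Definition okout b := if b is x :: _ then out x else true.

(** The induction on [s] adds vertices in front, so the first block [b0] and the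
    first run [u] are kept apart from the rest: a new vertex extends one of
    them, or turns [b0] into an excursion. *)
Lemma disassemble s : sorted e s -> ~~ all off s ->
  exists b0 u s2 U F b1,
  [/\ s = b0 ++ u ++ s2, perm_eq s2 (flatten U ++ flatten F ++ b1),
      size U = size F, all run (u :: U) & all excursion F] /\
  [/\ [&& sorted e b0, all off b0 & okin b0], sorted e b1, all off b1 & okout b1].
Proof.
elim: s => //= v s IH ps.
have ss := path_sorted ps.
rewrite negb_and; have [offs|noffs] := boolP (all off s).
  rewrite orbF /off negbK => cv.
  exists [::], [:: v], s, [::], [::], s; split; split=> //=; first by rewrite /run /= cv.
  case: s ps offs {IH ss} => //= y s /andP[evy _] /andP[oy _].
  rewrite /okout /out -(eqP cv) e_t //; rewrite (eqP cv) eq_sym; exact: oy.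
move=> _; have [b0 [u [s2 [U [F [b1 [[Es ps2 sUF rU exF] [/and3P[sb0 ob0 ib0] sb1 ob1 kb1]]]]]]]] := IH ss noffs.
have [cv|offv] := eqVneq (c v) w; last first.
  exists (v :: b0), u, s2, U, F, b1; split; split=> //; first by rewrite Es.
  rewrite /= ob0 {1}/off offv /=; case: b0 Es sb0 {ob0} ib0 => [|b b0] Es sb0 ib0.
    move: ps; rewrite Es; case: u rU {Es} => //= u1 u /andP[/and3P[_ _ /andP[/eqP cu _]] _] /andP[evu _].
    by rewrite /inn -cu e_t // cu.
  by move: ps; rewrite Es /= => /andP[-> _]; move: sb0 ib0 => /= -> ->.
case: b0 Es sb0 ob0 ib0 => [|b b0] Es sb0 ob0 ib0.
  exists [::], (v :: u), s2, U, F, b1; split; split=> //; first by rewrite Es.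
  move: rU => /= /andP[/and3P[u0 su cu] ->]; rewrite andbT /run /= cu cv eqxx andbT.
  by case: u u0 su ps {cu} Es => //= u1 u _ -> + Es; rewrite Es /= => /andP[->].
exists [::], [:: v], ((b :: b0) ++ u ++ s2), (u :: U), ((b :: b0) :: F), b1.
split; split=> //; first by rewrite Es.
- by apply/permP => a; have := permP ps2 a; rewrite /= !count_cat /= !count_cat; lia.
- by rewrite /= sUF.
- by apply/andP; split; rewrite // /run /= cv eqxx.
rewrite /= exF andbT; move: sb0 ob0 ib0 => /= -> /andP[ob ->] ->; rewrite ob /= andbT.
move: ps; rewrite Es /= => /andP[evb _].
by rewrite /out -cv e_t // cv eq_sym.
Qed.

Lemma gap s : all off s -> exists r1 r2, [/\ s = r1 ++ r2, okin r1 & okout r2].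
Proof.
elim: s => [|v s IH] /=; first by exists [::], [::].
case/andP=> ov /IH [r1 [r2 [-> i1 o2]]].
have [vo|nvo] := boolP (out v); first by exists [::], (v :: r1 ++ r2).
exists (v :: r1), r2; split=> //; case: r1 i1 {IH} => //= _.
exact: off_inn.
Qed.

Variable z0 : D.
Hypothesis hub : forall i, i != c z0 -> t i (c z0) && t (c z0) i.

Lemma hub_excursion b0 b1 : w != c z0 -> all (fun v => c v != c z0) (b0 ++ b1) ->
  [&& sorted e b0, all off b0 & okin b0] -> [&& sorted e b1, all off b1 & okout b1] ->
  excursion (b1 ++ z0 :: b0).
Proof.
move=> wz; rewrite all_cat => /andP[/allP n0 /allP n1] /and3P[s0 f0 k0] /and3P[s1 f1 k1].
have [wz1 wz2] := andP (hub wz).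
have pz : path e z0 b0 && inn (last z0 b0).
  case: b0 n0 s0 f0 k0 => [|b b0] n0 s0 f0 k0; first by rewrite /= /inn wz2.
  move: s0 k0 => /= -> ->; rewrite !andbT t_e //.
  by have /andP[] := hub (n0 b (mem_head _ _)).
have {pz} [pz iz] := andP pz.
have fz : off z0 by rewrite /off eq_sym.
case: b1 n1 s1 f1 k1 => [|b b1] n1 s1 f1 k1.
  by rewrite /= pz iz f0 fz /out wz1.
have el : e (last b b1) z0.
  by apply: t_e; have /andP[] := hub (n1 _ (mem_last b b1)).
move: s1 f1 k1 => /= s1 /andP[fb f1] ob.
by rewrite cat_path last_cat /= s1 el pz iz ob fb all_cat f1 /= fz f0.
Qed.

(** The two end blocks of the path [s] join through the universal vertex [z0]
    into one more excursion, so there are equally many runs and excursions.  If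
    [s] avoids the class there is no run, but [z0 :: s] can be rotated into a
    single excursion. *)
Lemma hub_disassemble s : w != c z0 -> all (fun v => c v != c z0) s ->
  sorted e s -> exists U F,
  [/\ perm_eq (z0 :: s) (flatten U ++ flatten F), all run U, all excursion F &
      size U = size F /\ 0 < size F \/ U = [::] /\ size F = 1].
Proof.
move=> wz ns ss; have [offs|noffs] := boolP (all off s).
  have [r1 [r2 [Es i1 o2]]] := gap offs.
  exists [::], [:: r2 ++ z0 :: r1]; split=> //; last by right.
    by rewrite Es; apply/permP => a; rewrite /= cats0 !count_cat /=; lia.
  rewrite /= andbT; move: ss offs ns; rewrite Es all_cat => ss /andP[f1 f2] ns.
  apply: hub_excursion => //; rewrite ?f1 ?f2 ?i1 ?o2 !andbT.
    by case: r1 ss {Es i1 ns f1} => //= b r1; rewrite cat_path => /andP[].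
  by case: r1 ss {Es i1 ns f1} => [|b r1] //=; rewrite cat_path => /andP[_ /path_sorted].
have [b0 [u [s2 [U [F [b1 [[Es ps2 sUF rU exF] [okb0 sb1 ob1 kb1]]]]]]]] := disassemble ss noffs.
exists (u :: U), ((b1 ++ z0 :: b0) :: F); split=> //; last by left; rewrite /= sUF.
  by rewrite Es; apply/permP => a; have := permP ps2 a; rewrite /= !count_cat /=; lia.
rewrite /= exF andbT; apply: hub_excursion => //; last by rewrite sb1 ob1 kb1.
move: ns; rewrite Es !all_cat (perm_all _ ps2) !all_cat.
by case/and3P=> -> _ /and3P[].
Qed.
End Excursions.

(** * Families of disjoint paths as cycles through hubs *)

Lemma mem_zip (A B : eqType) (s : seq A) (s' : seq B) p :
  p \in zip s s' -> (p.1 \in s) && (p.2 \in s').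
Proof.
elim: s s' => [|x s IH] [|y s'] //=; rewrite inE => /predU1P[->|/IH /andP[p1 p2]].
  by rewrite /= !inE !eqxx.
by rewrite !inE p1 p2 !orbT.
Qed.

Lemma leq_size_flatten (A : eqType) (R : seq (seq A)) :
  all (fun r => r != [::]) R -> size R <= size (flatten R).
Proof.
elim: R => //= r R IH /andP[r0 /IH]; rewrite size_cat.
by case: r r0 => //= v r _; lia.
Qed.

Section PathSystems.
Variables (T D : eqType) (t : rel T) (e : rel D) (c : D -> T).
Hypothesis t_irr : irreflexive t.
Hypothesis t_semi : forall i j, i != j -> t i j || t j i.
Hypothesis t_e : forall u v, t (c u) (c v) -> e u v.
Hypothesis e_t : forall u v, e u v -> c u != c v -> t (c u) (c v).

(** At most [k] paths rather than exactly [k]: then adding a vertex or joining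
    paths never leaves the notion, and [refine_system] recovers exactly [k]
    paths by cutting. *)
Definition path_system k (R : seq (seq D)) :=
  [&& size R <= k, all (fun r => (r != [::]) && sorted e r) R & uniq (flatten R)].

Section Hubs.
Variable k : nat.
Local Notation hub := 'I_k.+1.
Local Notation T' := (T + hub)%type.
Local Notation D' := (D + hub)%type.

Definition hub_t (x y : T') :=
  match x, y with
  | inl i, inl j => t i j
  | inr i, inr j => i != j
  | _, _ => true
  end.
Definition hub_e (x y : D') := if (x, y) is (inl u, inl v) then e u v else true.
Definition hub_c (x : D') : T' :=
  match x with inl v => inl (c v) | inr i => inr i end.

Lemma hub_t_irr : irreflexive hub_t.
Proof. by case=> i /=; rewrite ?t_irr ?eqxx. Qed.

Lemma hub_t_semi x y : x != y -> hub_t x y || hub_t y x.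
Proof.
case: x y => [i|i] [j|j] //= ij; first exact: t_semi.
by apply/orP; left.
Qed.

Lemma hub_t_e x y : hub_t (hub_c x) (hub_c y) -> hub_e x y.
Proof. by case: x y => [u|i] [v|j] //=; apply: t_e. Qed.

Lemma hub_e_t x y : hub_e x y -> hub_c x != hub_c y -> hub_t (hub_c x) (hub_c y).
Proof. by case: x y => [u|i] [v|j] //=; apply: e_t. Qed.

Lemma hub_universal (i : hub) x : x != hub_c (inr i) ->
  hub_t x (hub_c (inr i)) && hub_t (hub_c (inr i)) x.
Proof. by case: x => //= j ji; apply/andP; split; rewrite // eq_sym. Qed.

Local Notation hub_excursion w := (excursion hub_t hub_e hub_c (inl w)).

Fixpoint thread (R : seq (seq D)) (js : seq hub) : seq D' :=
  match R, js with
  | r :: R', j :: js' => [seq inl v | v <- r] ++ inr j :: thread R' js'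
  | r :: _, [::] => [seq inl v | v <- r]
  | [::], _ => [seq inr j | j <- js]
  end.

Lemma perm_thread R js : size R <= (size js).+1 ->
  perm_eq (thread R js) ([seq inl v | v <- flatten R] ++ [seq inr j | j <- js]).
Proof.
elim: R js => [|r R IH] [|j js] //=; first by case: R {IH} => //= _; rewrite !cats0.
rewrite ltnS => /IH /permP p; apply/permP => a; have := p a.
by rewrite map_cat !count_cat /=; lia.
Qed.

Lemma path_hubs x js : path hub_e x [seq inr j | j <- js].
Proof. by elim: js x => //= j js IH [] //= _; rewrite IH. Qed.

Lemma sorted_inl r : sorted hub_e [seq inl v | v <- r] = sorted e r.
Proof. by rewrite sorted_map; apply: eq_sorted. Qed.

Lemma sorted_hub_cat s j s' :
  sorted hub_e (s ++ inr j :: s') = sorted hub_e s && sorted hub_e s'.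
Proof.
have hj : path hub_e (inr j) s' = sorted hub_e s' by case: s'.
case: s => [|x s] //=; rewrite cat_path /= hj; congr andb.
by case: (last x s).
Qed.

Lemma sorted_thread R js : all (sorted e) R -> sorted hub_e (thread R js).
Proof.
elim: R js => [|r R IH] [|j js] //=; first by rewrite path_hubs.
  by case/andP=> sr _; rewrite sorted_inl.
by case/andP=> sr /IH {}IH; rewrite sorted_hub_cat sorted_inl sr IH.
Qed.

Fixpoint cut_hubs (s : seq D') : seq (seq D) :=
  match s with
  | [::] => [:: [::]]
  | inl v :: s' => let R := cut_hubs s' in (v :: head [::] R) :: behead R
  | inr _ :: s' => [::] :: cut_hubs s'
  end.

Lemma size_cut_hubs s : size (cut_hubs s) =
  (size (pmap (fun x : D' => if x is inr i then Some i else None) s)).+1.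
Proof. by elim: s => //= [[v|i]] s IH /=; rewrite ?size_behead IH. Qed.

Lemma flatten_cut_hubs s : flatten (cut_hubs s) =
  pmap (fun x : D' => if x is inl v then Some v else None) s.
Proof.
elim: s => //= [[v|i]] s /= <- //.
by have := size_cut_hubs s; case: (cut_hubs s).
Qed.

Lemma sorted_cut_hubs s : sorted hub_e s -> all (sorted e) (cut_hubs s).
Proof.
elim: s => //= [[v|i]] s IH ps /=; last exact/IH/(path_sorted ps).
have := IH (path_sorted ps); case: s ps {IH} => [|[u|j] s] //=.
by case/andP=> evu _ /andP[-> ->]; rewrite !andbT; exact: evu.
Qed.

(** The hub [ord0] plays the part of the universal vertex that closes the cycle,
    and the other [k] hubs separate the paths. *)
Lemma disassemble_system w R : path_system k.+1 R -> exists U F,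
  [/\ perm_eq ([seq inl v | v <- flatten R] ++ [seq inr j | j <- enum hub])
        ([seq inl v | v <- flatten U] ++ flatten F),
      all (run e c w) U, all (hub_excursion w) F &
      size U = size F /\ 0 < size F \/ U = [::] /\ size F = 1].
Proof.
case/and3P=> sR sortR uR; pose js := [seq lift ord0 i | i <- enum 'I_k].
have sortR' : all (sorted e) R by apply: sub_all sortR => r /andP[].
have szR : size R <= (size js).+1 by rewrite size_map size_enum_ord.
have off0 : all (fun v => hub_c v != hub_c (inr ord0)) (thread R js).
  rewrite (perm_all _ (perm_thread szR)) all_cat.
  apply/andP; split; first by apply/allP => _ /mapP[v _ ->].
  by apply/allP => _ /mapP[_ /mapP[i _ ->] ->].
have [U' [F [pUF rU exF sUF]]] :=
  @hub_disassemble _ _ hub_t hub_e hub_c hub_t_semi hub_t_e hub_e_t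
    (inl w) (inr ord0) (@hub_universal ord0) (thread R js) isT off0 (sorted_thread js sortR').
have [U [EU rU2]] : exists U, U' = [seq [seq inl v | v <- u] | u <- U] /\ all (run e c w) U.
  elim: U' rU {pUF sUF} => [|u' U' IH] /=; first by exists [::].
  case/andP=> /and3P[u0 su cu] /IH [U [-> rU]].
  have [u Eu] : exists u, u' = [seq inl v | v <- u].
    elim: u' cu {u0 su} => [|[v|i] u' IHu] //=; first by exists [::].
    by case/andP=> _ /IHu [u ->]; exists (v :: u).
  exists (u :: U); rewrite Eu /= rU andbT; split=> //.
  move: u0 su cu; rewrite Eu sorted_inl all_map /run => u0 -> cu.
  by case: u u0 cu {Eu}.
exists U, F; split=> //; last first.
  move: sUF; rewrite EU size_map => [[|[U0 sF]]]; [by left | right; split=> //].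
  by case: U U0 {EU rU2}.
have EfU : flatten U' = [seq inl v | v <- flatten U] by rewrite EU map_flatten.
rewrite -EfU; apply: perm_trans pUF.
apply: perm_trans (_ : perm_eq _ (inr ord0 :: [seq inl v | v <- flatten R] ++ [seq inr j | j <- js])) _; last first.
  by rewrite perm_cons perm_sym perm_thread.
by rewrite enum_ordSl /= perm_sym -cat_cons -cat1s -catA perm_catCA.
Qed.

(** The runs and excursions are woven into a cycle, and deleting its hubs cuts it
    into at most [k.+1] paths; one hub must be present, for a cycle without hubs
    would not be cut open. *)
Lemma assemble_system w U F : all (run e c w) U -> all (hub_excursion w) F ->
  size U = size F -> inr ord0 \in flatten F ->
  uniq (flatten U) -> uniq (flatten F) ->
  exists2 R, path_system k.+1 R &
    forall v, v \in flatten R = (v \in flatten U) || (inl v \in flatten F).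
Proof.
move=> rU exF sUF hF uU uF.
pose U' := [seq [seq inl v : D' | v <- u] | u <- U].
have rU' : all (run hub_e hub_c (inl w)) U'.
  rewrite all_map; apply: sub_all rU => u /and3P[u0 su cu].
  by rewrite /= /run sorted_inl su all_map cu; case: u u0 {su cu}.
have sUF' : size U' = size F by rewrite size_map.
have cyc := weave_cycle hub_t_e sUF' rU' exF.
have pW := perm_weave sUF'; rewrite /U' -map_flatten in pW.
have uW : uniq (weave U' F).
  rewrite (perm_uniq pW) cat_uniq map_inj_uniq ?uU ?uF ?andbT /=; last by move=> ? ? [].
  apply/hasPn => x xF; apply/mapP => [[v vU Ex]].
  have [f fF xf] := flattenP xF.
  have := allP (excursion_off (allP exF f fF)) x xf.
  have [u uin vu] := flattenP vU; have /and3P[_ _ /allP/(_ v vu)/eqP cv] := allP rU u uin.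
  by rewrite Ex /off /= cv eqxx.
have hW : inr ord0 \in weave U' F by rewrite (perm_mem pW) mem_cat hF orbT.
have [i s Ers] := rot_to hW.
have pS : perm_eq (inr ord0 :: s) (weave U' F) by rewrite -Ers perm_rot.
have sS : sorted hub_e s.
  by move: cyc; rewrite -(rot_cycle i) Ers /= rcons_path => /andP[/path_sorted].
have uS : uniq (inr ord0 :: s) by rewrite (perm_uniq pS).
exists [seq r <- cut_hubs s | r != [::]].
  have E0 : flatten [seq r <- cut_hubs s | r != [::]] = flatten (cut_hubs s).
    by elim: (cut_hubs s) => //= [[|v r]] R' /= -> .
  apply/and3P; split.
  - rewrite size_filter (leq_trans (count_size _ _)) // size_cut_hubs ltnS.
    have -> : size (pmap (fun x : D' => if x is inr i then Some i else None) s) =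
      (size (pmap (fun x : D' => if x is inr i then Some i else None) (inr ord0 :: s))).-1 by [].
    set p := pmap _ _.
    have : size p <= size (enum hub).
      apply: uniq_leq_size => [|j _]; last by rewrite mem_enum.
      by apply: (@pmap_uniq _ _ _ inr) => // [[]].
    by rewrite size_enum_ord; case: (size p).
  - apply/allP => r; rewrite mem_filter => /andP[-> rin] /=.
    exact: (allP (sorted_cut_hubs sS)).
  - rewrite E0 flatten_cut_hubs; apply: (@pmap_uniq _ _ _ inl) => [[]//|].
    by case/andP: uS.
move=> v.
have -> : flatten [seq r <- cut_hubs s | r != [::]] = flatten (cut_hubs s).
  by elim: (cut_hubs s) => //= [[|v' r]] R' /= -> .
rewrite flatten_cut_hubs mem_pmap.
have -> : (Some v \in [seq (if x is inl v then Some v else None) | x <- s]) = (inl v \in inr ord0 :: s).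
  rewrite inE /=; apply/mapP/idP => [[[u|j] // us [->]] //|vs]; by exists (inl v).
rewrite (perm_mem pS) (perm_mem pW) mem_cat mem_map //; by move=> ? ? [].
Qed.

End Hubs.

Lemma leq_size_runs w U : all (run e c w) U -> size U <= size (flatten U).
Proof. by move=> rU; apply: leq_size_flatten; apply: sub_all rU => u /and3P[]. Qed.

Lemma runs_class w U v : all (run e c w) U -> v \in flatten U -> c v = w.
Proof. by move=> rU /flattenP[u /(allP rU)/and3P[_ _ /allP cu] /cu/eqP]. Qed.

Lemma excursions_off k w (F : seq (seq (D + 'I_k.+1))) v :
  all (excursion (@hub_t k) (@hub_e k) (@hub_c k) (inl w)) F ->
  inl v \in flatten F -> c v != w.
Proof. by move=> exF /flattenP[f /(allP exF)/excursion_off/allP cf /cf]. Qed.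

Lemma disassembled_runs k w R U (F : seq (seq (D + 'I_k.+1))) :
  perm_eq ([seq inl v | v <- flatten R] ++ [seq inr j | j <- enum 'I_k.+1])
        ([seq inl v | v <- flatten U] ++ flatten F) ->
  all (run e c w) U ->
  all (excursion (@hub_t k) (@hub_e k) (@hub_c k) (inl w)) F ->
  [/\ perm_eq (flatten U) [seq v <- flatten R | c v == w],
     forall v, (inl v \in flatten F) = (v \in flatten R) && (c v != w),
     inr ord0 \in flatten F & uniq (flatten R) -> uniq (flatten F)].
Proof.
move=> pUF rU exF.
have inl_inj : injective (@inl D 'I_k.+1) by move=> ? ? [].
split.
- pose p (x : D + 'I_k.+1) := if x is inl v then c v == w else false.
  have E1 s : filter p (map inl s) = map inl [seq v <- s | c v == w] by rewrite filter_map.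
  have E2 js : filter p [seq inr j | j <- js] = [::] by elim: js.
  have E3 : filter p (flatten F) = [::].
    rewrite (@eq_in_filter _ _ pred0) ?filter_pred0 // => [[v|//]] vF /=.
    exact: negPf (excursions_off exF vF).
  have E4 : [seq v <- flatten U | c v == w] = flatten U.
    by apply/all_filterP/allP => v vU /=; rewrite (runs_class rU vU) eqxx.
  have := perm_filter p pUF; rewrite !filter_cat !E1 E2 E3 E4 !cats0.
  by move/(perm_map_inj inl_inj); rewrite perm_sym.
- move=> v; have := perm_mem pUF (inl v); rewrite !mem_cat !mem_map //.
  have -> : inl v \in [seq inr j | j <- enum 'I_k.+1] = false by apply/mapP => [[]].
  rewrite orbF => ->; have [cv|cv] /= := eqVneq (c v) w.
    by rewrite andbF; apply/negP => /(excursions_off exF); rewrite cv eqxx.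
  by rewrite andbT; case vU: (v \in flatten U); rewrite // (runs_class rU vU) eqxx in cv.
- have := perm_mem pUF (inr ord0); rewrite !mem_cat.
  rewrite (_ : inr ord0 \in [seq inr j | j <- _]) ?orbT; last by rewrite map_f // mem_enum.
  by rewrite (_ : inr ord0 \in [seq inl v | v <- flatten U] = false) //; apply/mapP => [[]].
- move=> uR; have : uniq ([seq inl v | v <- flatten U] ++ flatten F); last by rewrite cat_uniq => /and3P[].
  rewrite -(perm_uniq pUF) cat_uniq map_inj_uniq // uR map_inj_uniq ?enum_uniq ?andbT; last by move=> ? ? [].
  by apply/hasPn => _ /mapP[j _ ->]; apply/mapP => [[]].
Qed.

(** The excursions are kept and only the runs are replaced.  If [R] avoids the
    class there is still room for one run. *)
Lemma resegment k w R : path_system k.+1 R -> exists s U,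
  [/\ all (run e c w) U, perm_eq (flatten U) [seq v <- flatten R | c v == w],
      0 < s, size U = s \/ U = [::] /\ s = 1 &
      forall U', size U' = s -> all (run e c w) U' -> uniq (flatten U') ->
      exists2 R', path_system k.+1 R' &
        perm_eq (flatten R') ([seq v <- flatten R | c v != w] ++ flatten U')].
Proof.
move=> psR; have [U [F [pUF rU exF sUF]]] := disassemble_system w psR.
have /and3P[_ _ uR] := psR.
have [pU memF hF uF] := disassembled_runs pUF rU exF.
exists (size F), U; split=> //; first by case: sUF => [[]|[_ ->]].
  by case: sUF => [[->]|[-> ->]]; [left|right].
move=> U' sU' rU' uU'.
have [R' psR' memR'] := assemble_system rU' exF sU' hF uU' (uF uR).
exists R' => //; apply: uniq_perm; first by case/and3P: psR'.
  rewrite cat_uniq uU' filter_uniq // andbT; apply/hasPn => v /(runs_class rU') cv.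
  by rewrite mem_filter cv eqxx.
by move=> v; rewrite memR' memF mem_cat mem_filter andbC orbC.
Qed.

(** The pairs of a vertex of class [a] and one of class [b], or the single
    vertices if [a = b], are excursions from [w], and a hub is another.  Together they outnumber the runs of [R], each of which
    uses a vertex of the class; so the excursions of [R] can be augmented, which
    leaves room for the run formed by [x]. *)
Lemma absorb k R w x a b As Bs : path_system k.+1 R -> c x = w ->
  x \notin flatten R -> t w a -> t b w -> (a == b) || t a b ->
  all (fun v => c v == a) As -> all (fun v => c v == b) Bs ->
  uniq As -> uniq Bs -> size As = size Bs ->
  count (fun v => c v == w) (flatten R) <= size As ->
  exists R', [/\ path_system k.+1 R', {subset x :: flatten R <= flatten R'} &
    {subset flatten R' <= x :: flatten R ++ As ++ Bs}].
Proof.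
move=> psR cx xR twa tbw ab cA cB uA uB sAB leRA.
have [U [F [pUF rU exF sUF]]] := disassemble_system w psR.
have /and3P[_ _ uR] := psR.
have [pU memF hF uF] := disassembled_runs pUF rU exF.
pose G0 : seq (seq (D + 'I_k.+1)) := if a == b then [seq [:: inl v] | v <- As]
  else [seq [:: inl p.1; inl p.2] | p <- zip As Bs].
have aw : a != w by apply: contraTneq twa => ->; rewrite t_irr.
have bw : b != w by apply: contraTneq tbw => ->; rewrite t_irr.
have sG0 : size G0 = size As.
  by rewrite /G0; case: ifP => _; rewrite size_map // size1_zip // sAB.
have exG0 : all (excursion (@hub_t k) (@hub_e k) (@hub_c k) (inl w)) G0.
  rewrite /G0; case: eqP ab => [Eab _|_ /= tab]; rewrite all_map; apply/allP => p pA /=.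
    have cp : c p = a := eqP (allP cA p pA).
    by rewrite /out /inn /off /= cp twa Eab tbw (inj_eq (@inl_inj T _)) bw.
  have /andP[p1 p2] := mem_zip pA.
  have c1 : c p.1 = a := eqP (allP cA _ p1).
  have c2 : c p.2 = b := eqP (allP cB _ p2).
  have e12 : e p.1 p.2 by apply: t_e; rewrite c1 c2.
  by rewrite /out /inn /off /hub_e /= c1 c2 e12 twa tbw !(inj_eq (@inl_inj T _)) aw bw.
have memG0 x' : x' \in flatten G0 -> exists2 v, x' = inl v & v \in As ++ Bs.
  rewrite /G0; case: ifP => _ /flatten_mapP[y yin]; rewrite !inE.
    by move/eqP->; exists y; rewrite // mem_cat yin.
  have /andP[y1 y2] := mem_zip yin.
  by case/orP=> /eqP->; [exists y.1 | exists y.2]; rewrite // mem_cat ?y1 ?y2 ?orbT.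
have uG0 : uniq (flatten G0).
  rewrite /G0; case: eqP => [_|/eqP nab].
    have -> : flatten [seq [:: inl v] | v <- As] = map (@inl D 'I_k.+1) As by elim: (As) => //= v s ->.
    by rewrite map_inj_uniq // => ? ? [].
  have pz : perm_eq (flatten [seq [:: inl p.1; inl p.2] | p <- zip As Bs])
      (map (@inl D 'I_k.+1) (As ++ Bs)).
    apply: perm_trans (flatten_map_cat (fun p : D * D => [:: inl p.1]) (fun p => [:: inl p.2]) _) _.
    rewrite map_cat; have E (Z : Type) (g : Z -> D) s : flatten [seq [:: @inl D 'I_k.+1 (g p)] | p <- s] = map inl (map g s).
      by elim: s => //= p s ->.
    by rewrite !E -/(unzip1 _) -/(unzip2 _) unzip1_zip ?unzip2_zip ?sAB.
  rewrite (perm_uniq pz) map_inj_uniq; last by move=> ? ? [].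
  rewrite cat_uniq uA uB andbT /=; apply/hasPn => v vB; apply: contra nab => vA.
  by rewrite -(eqP (allP cA v vA)) (eqP (allP cB v vB)).
have nG0 i : inr i \notin flatten G0 by apply/negP => /memG0 [].
pose G := [:: inr ord0] :: G0.
have exG : all (excursion (@hub_t k) (@hub_e k) (@hub_c k) (inl w)) G by rewrite /= exG0.
have uG : uniq (flatten G) by rewrite /= nG0.
have sU : size U <= size As.
  apply: leq_trans leRA; rewrite -size_filter -(perm_size pU).
  exact: leq_size_runs rU.
have [|F' [sF' exF' uF' sub1 sub2]] :=
  @augment_to _ _ _ _ _ (@hub_t_irr k) (@hub_t_semi k) (@hub_t_e k) (@hub_e_t k) _ F G (size U).+1 exF exG (uF uR) uG.
  rewrite /= sG0 ltnS sU andbT; case: sUF => [[->]|[-> ->]] //.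
have [||||||R' psR' memR'] := @assemble_system k w ([:: x] :: U) F'.
- by rewrite /= rU /run /= cx eqxx.
- by [].
- by rewrite sF'.
- exact: sub1.
- by rewrite /= (perm_uniq pU) filter_uniq // (perm_mem pU) mem_filter (negPf xR) andbF.
- by [].
exists R'; split=> // v.
  rewrite inE memR' /= inE => /predU1P[->|vR]; first by rewrite eqxx.
  rewrite (perm_mem pU) mem_filter vR andbT.
  have [cv|cv] := boolP (c v == w); first by rewrite orbT.
  by rewrite sub1 ?orbT // memF vR cv.
rewrite memR' inE mem_cat /= inE => /orP[/orP[->//|]|].
  by rewrite (perm_mem pU) mem_filter => /andP[_ ->]; rewrite orbT.
move=> /sub2; rewrite mem_cat memF => /orP[/andP[->]|]; first by rewrite orbT.
by rewrite /= inE /= => /memG0 [v' [->] ->]; rewrite !orbT.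
Qed.

(** The excursions of [R] are augmented until they are as many as the runs of
    [P] in class [m], and these runs are then inserted. *)
Lemma absorb_class k R P m : path_system k.+1 R -> path_system 1 [:: P] ->
  all (fun v => c v != m) (flatten R) ->
  exists2 R', path_system k.+1 R' &
    {subset flatten R ++ [seq v <- P | c v == m] <= flatten R'}.
Proof.
move=> psR psP offR.
have /and3P[_ _ uR] := psR.
have psP' : path_system k.+1 [:: P] by case/and3P: psP => ? ? ?; apply/and3P.
have uP : uniq (flatten [:: P]) by case/and3P: psP.
have [U [F [pUF rU exF sUF]]] := disassemble_system m psR.
have [UP [FP [pUFP rUP exFP sUFP]]] := disassemble_system m psP'.
have [pU memF hF uF] := disassembled_runs pUF rU exF.
have [pUP memFP hFP uFP] := disassembled_runs pUFP rUP exFP.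
have U0 : U = [::].
  have : size (flatten U) = 0.
    rewrite (perm_size pU) size_filter; apply/eqP; rewrite -leqn0 leqNgt -has_count.
    by apply/hasPn => v /(allP offR).
  by move=> s0; apply/eqP; rewrite -size_eq0 -leqn0 -s0; apply: leq_size_runs rU.
have sF : size F = 1 by move: sUF; rewrite U0 => [[[<-]|[]]].
rewrite /= cats0 in pUP.
case: (eqVneq UP [::]) => [UP0|UPn].
  exists R => // v; rewrite mem_cat -(perm_mem pUP) UP0 /= in_nil orbF //.
have sUFP' : size UP = size FP /\ 0 < size FP by case: sUFP => // [[]] /eqP; rewrite (negPf UPn).
have [|F' [sF' exF' uF' sub1 sub2]] :=
  @augment_to _ _ _ _ _ (@hub_t_irr k) (@hub_t_semi k) (@hub_t_e k) (@hub_e_t k) _ F FP (size UP) exF exFP (uF uR) (uFP uP).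
  by rewrite sF; case: sUFP' => ->; rewrite leqnn andbT.
have uUP : uniq (flatten UP) by rewrite (perm_uniq pUP) filter_uniq // -[P]cats0.
have [R' psR' memR'] := assemble_system rUP exF' (esym sF') (sub1 _ hF) uUP uF'.
exists R' => // v; rewrite mem_cat memR' (perm_mem pUP) orbC => /orP[->//|vR].
by rewrite sub1 ?orbT // memF vR (allP offR).
Qed.

End PathSystems.

(** * Path orders of digraphs *)

Lemma refine_system (D : eqType) (e : rel D) k (R : seq (seq D)) :
  path_system e k R -> k <= size (flatten R) ->
  exists R', [/\ path_system e k R', size R' = k & flatten R' = flatten R].
Proof.
move=> psR lek; have [szR _ _] := and3P psR.
have : k <= (k - size R) + size R by lia.
move: (k - size R) => d; elim: d R psR lek szR => [|d IH] R psR lek szR ltd.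
  by exists R; split=> //; apply/eqP; rewrite eqn_leq szR.
have [sRk|neR] := eqVneq (size R) k; first by exists R.
have ltR : size R < k by rewrite ltn_neqAle neR.
have [R1 [E s1 ok1]] : exists R1, [/\ flatten R1 = flatten R, size R1 = (size R).+1
    & all (fun r => (r != [::]) && sorted e r) R1].
  have {IH ltd szR neR d} : size R < size (flatten R) by apply: leq_trans lek.
  case/and3P: psR => _ okR _ {lek ltR}; elim: R okR => //= r R IH /andP[/andP[r0 sr] okR].
  case: r r0 sr => // x [|y r] _ sr; rewrite size_cat /=.
    rewrite !add1n ltnS => /(IH okR) [R1 [E s1 ok1]].
    by exists ([:: x] :: R1); rewrite /= E s1 ok1.
  move=> _; exists ([:: x] :: (y :: r) :: R); split=> //=; rewrite okR andbT.
  by case/andP: sr.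
have [||||R' [psR' sR' ER']] := IH R1; last by exists R'; rewrite ER'.
- by case/and3P: psR => _ _ uR; apply/and3P; rewrite s1 E.
- by rewrite E.
- by rewrite s1.
- by rewrite s1; lia.
Qed.

Lemma bigmax_attained (I : finType) (P : pred I) (F : I -> nat) i0 : P i0 ->
  exists2 i, P i & \max_(i | P i) F i = F i.
Proof.
move=> Pi0; have : 0 < #|P| by apply/card_gt0P; exists i0.
by case/(eq_bigmax_cond F) => i Pi E; exists i.
Qed.

Lemma uniq_in_flatten (A : eqType) (R : seq (seq A)) r :
  uniq (flatten R) -> r \in R -> uniq r.
Proof.
move=> uR /path.splitPr E; case: E uR => R1 R2.
by rewrite flatten_cat cat_uniq /= cat_uniq => /and3P[_ _ /and3P[]].
Qed.

Section PathOrders.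
Variable D : digraph.

Lemma uniq_bpath (p : seq D) : uniq p -> bseqval (insub_bseq #|D| p) = p.
Proof.
move=> up; have le_p : size p <= #|D| by rewrite -(card_uniqP up) max_card.
by rewrite /insub_bseq /insubd insubT.
Qed.

Lemma size_le_lambda (p : seq D) : sorted (@darc D) p -> uniq p -> size p <= lambda D.
Proof.
case: p => // x p sp up; have E := uniq_bpath up.
by rewrite -{1}E /lambda (leq_bigmax_cond (insub_bseq _ _)) // E /is_dipath sp up.
Qed.

Lemma lambda_path : exists p : seq D,
  [/\ sorted (@darc D) p, uniq p & size p = lambda D].
Proof.
have [p0 dp0|none] := pickP (fun p : bpath D => is_dipath p).
  have [p /and3P[_ sp up] E] := @bigmax_attained _ (fun p : bpath D => is_dipath p) (fun p => size p) p0 dp0.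
  by exists p.
by exists [::]; split=> //; rewrite /lambda big_pred0.
Qed.

Lemma size_le_lambda_k k (R : seq (seq D)) : path_system (@darc D) k R ->
  k <= size (flatten R) -> size (flatten R) <= lambda_k k D.
Proof.
move=> psR lek; have [R' [/and3P[_ /allP okR uR] sR <-]] := refine_system psR lek.
have uR' r : r \in R' -> uniq r by apply: uniq_in_flatten.
pose P : seq (bpath D) := [seq insub_bseq #|D| r | r <- R'].
have sP : size P == k by rewrite size_map sR.
have EP : kpath_vertices (Tuple sP) = flatten R'.
  rewrite /kpath_vertices /= -map_comp; congr flatten; rewrite -[RHS]map_id.
  by apply/eq_in_map => r rR; rewrite /= uniq_bpath // uR'.
rewrite -EP /lambda_k (leq_bigmax_cond (Tuple sP)) // /is_kpath EP uR andbT.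
apply/allP => _ /mapP[r rR ->]; rewrite /is_dipath uniq_bpath ?uR' //.
by have /andP[-> ->] := okR r rR.
Qed.

Lemma lambda_k_paths k : k <= #|D| -> exists R : seq (seq D),
  [/\ path_system (@darc D) k R, size R = k & size (flatten R) = lambda_k k D].
Proof.
move=> lek; pose P0 : seq (bpath D) := [seq insub_bseq #|D| [:: x] | x <- take k (enum D)].
have sP0 : size P0 == k by rewrite size_map size_takel // -cardE.
have E0 : kpath_vertices (Tuple sP0) = take k (enum D).
  rewrite /kpath_vertices /= -map_comp (eq_map (g := fun x => [:: x])); last first.
    by move=> x; rewrite /= uniq_bpath.
  by elim: (take k (enum D)) => //= x s ->.
have kp0 : is_kpath (Tuple sP0).
  rewrite /is_kpath E0 take_uniq ?enum_uniq // andbT.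
  by apply/allP => _ /mapP[x _ ->]; rewrite /is_dipath uniq_bpath.
have [P /andP[/allP dP uP] E] := @bigmax_attained _ (@is_kpath D k) (fun P => size (kpath_vertices P)) _ kp0.
exists [seq bseqval p | p <- P]; split=> //; last by rewrite size_map size_tuple.
apply/and3P; split=> //; first by rewrite size_map size_tuple.
by apply/allP => _ /mapP[p pP ->]; have /and3P[-> ->] := dP p pP.
Qed.
End PathOrders.

Lemma lift_to_image (A B : eqType) (f : A -> B) (p : seq B) :
  (forall v, v \in p -> exists u, v = f u) -> exists q, p = map f q.
Proof.
elim: p => [|v p IH] fp; first by exists [::].
have [u ->] := fp v (mem_head _ _).
by have [|q ->] := IH; [move=> w wp; apply: fp; rewrite inE wp orbT | exists (u :: q)].
Qed.

(** Induced subdigraphs and factors of a composition both embed into the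
    composition; their path orders are computed there. *)
Section Embedding.
Variables (D1 D2 : digraph) (f : D1 -> D2).
Hypothesis f_inj : injective f.
Hypothesis f_arc : forall x y, darc (f x) (f y) = darc x y.

Lemma sorted_emb q : sorted (@darc D2) (map f q) = sorted (@darc D1) q.
Proof. by rewrite sorted_map; apply: eq_sorted => x y; apply: f_arc. Qed.

Lemma path_system_emb k R :
  path_system (@darc D2) k (map (map f) R) = path_system (@darc D1) k R.
Proof.
rewrite /path_system size_map -map_flatten map_inj_uniq // all_map; congr [&& _, _ & _].
by apply: eq_all => r /=; rewrite sorted_emb; case: r.
Qed.

Lemma size_le_lambda_emb (p : seq D2) : sorted (@darc D2) p -> uniq p ->
  (forall v, v \in p -> exists u, v = f u) -> size p <= lambda D1.
Proof.
move=> sp up /lift_to_image [q Eq]; rewrite Eq size_map size_le_lambda //.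
  by rewrite -sorted_emb -Eq.
by rewrite -(map_inj_uniq f_inj) -Eq.
Qed.

Lemma lambda_path_emb : exists p : seq D2, [/\ sorted (@darc D2) p, uniq p,
  size p = lambda D1 & forall v, v \in p -> exists u, v = f u].
Proof.
have [q [sq uq <-]] := lambda_path D1; exists (map f q).
rewrite sorted_emb map_inj_uniq // size_map; split=> // _ /mapP[u _ ->]; by exists u.
Qed.

Lemma size_le_lambda_k_emb k (R : seq (seq D2)) : path_system (@darc D2) k R ->
  k <= size (flatten R) -> (forall v, v \in flatten R -> exists u, v = f u) ->
  size (flatten R) <= lambda_k k D1.
Proof.
move=> psR lek imR; have [R1 E] : exists R1, R = map (map f) R1.
  apply: lift_to_image => r rR; apply: lift_to_image => v vr; apply: imR.
  by apply/flattenP; exists r.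
move: psR lek; rewrite E path_system_emb -map_flatten size_map.
exact: size_le_lambda_k.
Qed.

Lemma lambda_k_paths_emb k : k <= #|D1| -> exists R : seq (seq D2),
  [/\ path_system (@darc D2) k R, size R = k, size (flatten R) = lambda_k k D1
    & forall v, v \in flatten R -> exists u, v = f u].
Proof.
case/lambda_k_paths => R [psR sR <-]; exists (map (map f) R).
rewrite path_system_emb size_map -map_flatten size_map; split=> // _ /mapP[u _ ->].
by exists u.
Qed.
End Embedding.

(** * Paths in compositions *)

Section Composition.
Variables (T : digraph) (H : T -> digraph).
Hypothesis T_semi : semicomplete T.
Hypothesis H_nonempty : forall i : T, 0 < #|H i|.

Local Notation Q := (composition H).
Local Notation t := (@darc T).
Local Notation e := (@darc Q).
Local Notation cls := (fun v : Q => tag v).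
Local Notation systems := (path_system e).

Lemma comp_arc_between (u v : Q) : t (cls u) (cls v) -> e u v.
Proof. by rewrite /= /comp_arc => ->; rewrite orbT. Qed.

Lemma comp_arc_tag (u v : Q) : e u v -> cls u != cls v -> t (cls u) (cls v).
Proof. by rewrite /= /comp_arc => /orP[/andP[-> //]|//]. Qed.

Definition factor_elt i (x : H i) : Q := Tagged (fun i => H i) x.

Lemma factor_elt_inj i : injective (@factor_elt i).
Proof. by move=> x y /eqP; rewrite /factor_elt -tag_eqE /tag_eq /= eqxx tagged_asE => /eqP. Qed.

Lemma factor_elt_arc i x y : darc (@factor_elt i x) (factor_elt y) = darc x y.
Proof. by rewrite /= /comp_arc /= eqxx tagged_asE darc_irr orbF. Qed.

Lemma factor_eltP i (v : Q) : tag v = i -> exists x, v = @factor_elt i x.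
Proof. by case: v => j x /= <-; exists x. Qed.

Definition factor_seq i : seq Q := [seq factor_elt x | x <- enum (H i)].

Lemma mem_factor_seq i (v : Q) : (v \in factor_seq i) = (tag v == i).
Proof.
apply/mapP/eqP => [[x _ ->] //|/factor_eltP[x ->]].
by exists x; rewrite ?mem_enum.
Qed.

Lemma uniq_factor_seq i : uniq (factor_seq i).
Proof. by rewrite map_inj_uniq ?enum_uniq //; apply: factor_elt_inj. Qed.

Lemma size_factor_seq i : size (factor_seq i) = #|H i|.
Proof. by rewrite size_map -cardE. Qed.

Lemma factor_path i : exists p : seq Q, [/\ sorted e p, uniq p,
  size p = lambda (H i) & all (fun v => cls v == i) p].
Proof.
have [p [sp up zp imp]] := lambda_path_emb (@factor_elt_inj i) (@factor_elt_arc i).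
by exists p; split=> //; apply/allP => v /imp [x ->].
Qed.

Lemma size_le_lambda_factor i (p : seq Q) : sorted e p -> uniq p ->
  all (fun v => cls v == i) p -> size p <= lambda (H i).
Proof.
move=> sp up /allP cp.
apply: (size_le_lambda_emb (@factor_elt_inj i) (@factor_elt_arc i)) => // v /cp /eqP.
exact: factor_eltP.
Qed.

Lemma lambda_factor_gt0 i : 0 < lambda (H i).
Proof.
have [x _] := card_gt0P (H_nonempty i).
by have := @size_le_lambda_factor i [:: factor_elt x]; rewrite /= eqxx; apply.
Qed.

Lemma insert_factor k R i : systems k.+1 R -> all (fun v => cls v != i) (flatten R) ->
  exists R', [/\ systems k.+1 R', size (flatten R') = size (flatten R) + lambda (H i) &
    forall v, v \in flatten R' -> cls v = i \/ v \in flatten R].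
Proof.
move=> psR offR.
have [s [U [rU pU s0 sU swap]]] := resegment T_semi comp_arc_between comp_arc_tag i psR.
have U0 : U = [::].
  apply/eqP; rewrite -size_eq0 -leqn0 (leq_trans (leq_size_runs rU)) //.
  rewrite (perm_size pU) size_filter leqNgt -has_count; apply/hasPn => v /(allP offR).
  by [].
have s1 : s = 1 by case: sU s0 => [<-|[]]; rewrite U0.
have [p [sp up zp cp]] := factor_path i.
have rp : run e cls i p by rewrite /run sp cp -size_eq0 zp -lt0n lambda_factor_gt0.
have [|||R' psR' pR'] := swap [:: p]; rewrite /= ?s1 ?rp ?cats0 //.
have EF : [seq v <- flatten R | cls v != i] = flatten R by apply/all_filterP.
exists R'; split=> //; first by rewrite (perm_size pR') size_cat EF /= cats0 zp.
move=> v; rewrite (perm_mem pR') EF mem_cat /= cats0 => /orP[]; first by right.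
by move=> /(allP cp)/eqP; left.
Qed.

Lemma insert_factors k R (js : seq T) : systems k.+1 R -> uniq js ->
  all (fun v => cls v \notin js) (flatten R) ->
  exists R', [/\ systems k.+1 R',
    size (flatten R') = size (flatten R) + \sum_(j <- js) lambda (H j) &
    forall v, v \in flatten R' -> cls v \in js \/ v \in flatten R].
Proof.
move=> psR; elim: js => [|j js IH] /=.
  by exists R; split=> //; [rewrite big_nil addn0 | right].
case/andP=> njs ujs offR.
have offR1 : all (fun v => cls v \notin js) (flatten R).
  by apply: sub_all offR => v; rewrite inE negb_or => /andP[].
have [R1 [psR1 sR1 memR1]] := IH ujs offR1.
have offj : all (fun v => cls v != j) (flatten R1).
  apply/allP => v /memR1 [vjs|/(allP offR)]; first by apply: contraNneq njs => <-.
  by rewrite inE negb_or => /andP[].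
have [R2 [psR2 sR2 memR2]] := insert_factor psR1 offj.
exists R2; split=> //; first by rewrite sR2 sR1 big_cons -addnA; congr addn; rewrite addnC.
move=> v /memR2 [->|/memR1 [vjs|]]; [left | left | by right].
  by rewrite mem_head.
by rewrite inE vjs orbT.
Qed.

Definition longest (p : seq Q) := [/\ sorted e p, uniq p & size p = lambda Q].

Lemma single_system (p : seq Q) : p != [::] -> sorted e p -> uniq p -> systems 1 [:: p].
Proof. by move=> p0 sp up; rewrite /path_system /= cats0 p0 sp up. Qed.

Lemma size_system1 R : systems 1 R -> size (flatten R) <= lambda Q.
Proof.
case/and3P; case: R => [|r [|]] //= _; rewrite cats0 andbT => /andP[_ sr] ur.
exact: size_le_lambda.
Qed.

Lemma lambda_comp_gt0 : T -> 0 < lambda Q.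
Proof.
move=> i; have [x _] := card_gt0P (H_nonempty i).
exact: (@size_le_lambda Q [:: factor_elt x]).
Qed.

Lemma longest_neq0 p : longest p -> T -> p != [::].
Proof. by case=> _ _ sp /lambda_comp_gt0; rewrite -sp; case: p {sp}. Qed.

Lemma count_le_max_cover p i : longest p -> T ->
  count (fun v => cls v == i) p <= max_cover H i.
Proof.
move=> lp /(longest_neq0 lp) p0; case: lp => sp up zp.
have Ep := @uniq_bpath Q p up.
rewrite /max_cover; apply: (bigmax_sup (insub_bseq _ p)).
  by rewrite /is_longest_path Ep /is_dipath p0 sp up zp eqxx.
rewrite Ep -size_filter -(card_uniqP (filter_uniq _ up)).
apply/subset_leq_card/subsetP => v; rewrite inE mem_filter => /andP[-> ->] //.
Qed.

Lemma max_cover_attained i : T -> exists2 p, longest p &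
  count (fun v => cls v == i) p = max_cover H i.
Proof.
move=> i0; have [p0 [sp0 up0 zp0]] := lambda_path Q.
have n0 := longest_neq0 (And3 sp0 up0 zp0) i0.
have l0 : is_longest_path (bseqval (insub_bseq #|Q| p0)).
  by rewrite /is_longest_path uniq_bpath // /is_dipath n0 sp0 up0 zp0 eqxx.
have [p /andP[/and3P[_ sp up] /eqP zp] E] := @bigmax_attained _
  (fun p : bpath Q => is_longest_path p)
  (fun p => #|[set x : Q | (x \in bseqval p) && (tag x == i)]|) _ l0.
exists p; first by split.
rewrite /max_cover E -size_filter -(card_uniqP (filter_uniq _ up)).
by apply: eq_card => v; rewrite inE mem_filter andbC.
Qed.

Lemma max_cover_le i : T -> max_cover H i <= #|H i|.
Proof.
move=> /(max_cover_attained i) [p [_ up _] <-].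
rewrite -size_filter -size_factor_seq uniq_leq_size ?filter_uniq // => v.
by rewrite mem_filter mem_factor_seq => /andP[].
Qed.

(** If a longest path [p] covers fewer vertices of [H i], a longest path of
    [H i] can be cut into as many runs as [p] has and replace them. *)
Lemma lambda_factor_le_max_cover i : lambda (H i) <= max_cover H i.
Proof.
have [p lp Ep] := max_cover_attained i i; rewrite -Ep leqNgt; apply/negP => ltp.
have psp : systems 1 [:: p] by have p0 := longest_neq0 lp i; case: lp => *; apply: single_system.
have [s [U [rU pU s0 sU swap]]] := resegment T_semi comp_arc_between comp_arc_tag i psp.
have [r [sr ur zr cr]] := factor_path i.
have r0 : r != [::] by rewrite -size_eq0 zr -lt0n lambda_factor_gt0.
have psr : systems s [:: r].
  by rewrite /path_system /= cats0 r0 sr ur s0.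
rewrite /= cats0 in pU swap.
have ser : s <= size (flatten [:: r]).
  rewrite /= cats0 zr; case: sU => [<-|[_ ->]]; last exact: lambda_factor_gt0.
  apply: leq_trans (leq_size_runs rU) _; rewrite (perm_size pU) size_filter; exact: ltnW.
have [U' [/and3P[_ okU' uU'] sU' EU']] := refine_system psr ser.
rewrite /= cats0 in EU'.
have rU' : all (run e cls i) U'.
  apply/allP => u uU; have /andP[u0 su] := allP okU' u uU.
  rewrite /run u0 su /=; apply/allP => v vu; apply: (allP cr).
  by rewrite -EU'; apply/flattenP; exists u.
have [R' psR' pR'] := swap U' sU' rU' uU'.
have := size_system1 psR'; case: lp => _ _ <-.
rewrite (perm_size pR') EU' size_cat zr size_filter.
by rewrite -(count_predC (fun v => cls v == i) p) addnC leq_add2r leqNgt ltp.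
Qed.

(** Otherwise [H w] has more than [#|H m|] vertices, hence more than any longest
    path covers, because [max_cover H w <= max_cover H m].  But then the cycle
    through [a] and [b], whose factors have at least [#|H m|] vertices, lets the
    longest path absorb a missing vertex of [H w]. *)
Lemma cycle_factor_bound m w a b : (forall i, max_cover H i <= max_cover H m) ->
  t w a -> (a == b) || t a b -> t b w -> #|H m| <= #|H a| -> #|H m| <= #|H b| ->
  #|H w| <= #|H m|.
Proof.
move=> m_max twa tab tbw lema lemb; rewrite leqNgt; apply/negP => ltmw.
have [p lp _] := max_cover_attained w w.
have lew : count (fun v => cls v == w) p <= #|H m|.
  apply: leq_trans (count_le_max_cover w lp w) _.
  by apply: leq_trans (m_max w) (max_cover_le m m).
have psp : systems 1 [:: p] by have p0 := longest_neq0 lp m; case: lp => *; apply: single_system.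
have [x cx xp] : exists2 x : Q, tag x = w & x \notin p.
  have [|/allPn[x]] := boolP (all (fun x => x \in p) (factor_seq w)); last first.
    by rewrite mem_factor_seq => /eqP; exists x.
  move=> /allP sub; have : #|H w| <= count (fun v => cls v == w) p.
    rewrite -size_factor_seq -size_filter uniq_leq_size ?uniq_factor_seq // => v vw.
    by rewrite mem_filter sub // andbT -mem_factor_seq.
  by rewrite leqNgt (leq_ltn_trans lew ltmw).
have clsA i : all (fun v => cls v == i) (take #|H m| (factor_seq i)).
  by apply/allP => v /mem_take; rewrite mem_factor_seq.
have uA i : uniq (take #|H m| (factor_seq i)) by rewrite take_uniq ?uniq_factor_seq.
have sA i : #|H m| <= #|H i| -> size (take #|H m| (factor_seq i)) = #|H m|.
  by move=> lei; rewrite size_takel // size_factor_seq.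
have [|||R' [psR' sub _]] := absorb (darc_irr (d := T)) T_semi comp_arc_between comp_arc_tag psp cx _ twa tbw tab
  (clsA a) (clsA b) (uA a) (uA b).
- by rewrite /= cats0.
- by rewrite !sA.
- by rewrite sA //= cats0.
have := size_system1 psR'; case: (lp) => _ up <-; rewrite leqNgt => /negP; apply.
rewrite -[(size p).+1]/(size (x :: p)); apply: uniq_leq_size.
  by rewrite /= xp.
by move=> v vp; apply: sub; rewrite /= cats0.
Qed.

(** A transitive tournament, expressed by the absence of cycles of length 2 (the
    case [b = d]) and 3. *)
Definition transitive_classes (I : {set T}) := forall a b d,
  a \in I -> b \in I -> d \in I -> t a b -> (b == d) || t b d -> ~~ t d a.

Definition returns (w a b : T) := [&& t w a, (a == b) || t a b & t b w].

(** An index is left out only if it closes a cycle with indices chosen before it,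
    which are [m] or have factors that are at least as large. *)
Lemma greedy_transitive m (s : seq T) :
  pairwise (fun i j => #|H j| <= #|H i|) s ->
  exists I : {set T}, [/\ m \in I, transitive_classes I, {subset I <= m :: s} &
    forall w, w \in s -> w \notin I -> exists a b,
      [/\ a \in I, b \in I, returns w a b,
          (#|H w| <= #|H a|) || (a == m) & (#|H w| <= #|H b|) || (b == m)]].
Proof.
elim/last_ind: s => [|s w0 IH].
  exists [set m]; split=> //; first by rewrite set11.
    by move=> a b d; rewrite !inE => /eqP-> /eqP-> _; rewrite darc_irr.
  by move=> x; rewrite !inE.
rewrite pairwise_rcons => /andP[/allP le0 /IH [I [mI trI subI retI]]].
have [/existsP[a /existsP[b /and3P[aI bI ret]]]|none] :=
  boolP [exists a, [exists b, [&& a \in I, b \in I & returns w0 a b]]].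
  have big x : x \in I -> (#|H w0| <= #|H x|) || (x == m).
    move=> /subI; rewrite inE => /predU1P[->|/le0 ->//]; by rewrite eqxx orbT.
  exists I; split=> //; first by move=> x /subI; rewrite !inE mem_rcons inE => /orP[->//|->]; rewrite !orbT.
  move=> w; rewrite mem_rcons inE => /predU1P[->|]; last exact: retI.
  by move=> _; exists a, b; rewrite !big.
have noret a b : a \in I -> b \in I -> ~~ returns w0 a b.
  move=> aI bI; apply: contra none => ret; apply/existsP; exists a.
  by apply/existsP; exists b; rewrite aI bI.
exists (w0 |: I); split.
- by rewrite inE mI orbT.
- move=> a b d; rewrite !inE.
  case/predU1P=> [->|aI]; case/predU1P=> [->|bI]; case/predU1P=> [->|dI];
    rewrite ?darc_irr //.
  + move=> t1 t2; have := noret _ _ bI dI; by rewrite /returns t1 t2.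
  + move=> t1 _; have := noret _ _ aI aI; by rewrite /returns t1 eqxx /= andbT.
  + move=> t1 /predU1P[<-|t2]; first by have := noret _ _ aI aI; rewrite /returns t1 eqxx /= andbT.
    by have := noret _ _ dI aI; rewrite /returns t2 t1 andbT /= negb_or => /andP[].
  + move=> t1 /predU1P[E|t2]; last by have := noret _ _ aI bI; rewrite /returns t1 t2 orbT !andbT.
    by have := noret _ _ aI aI; rewrite /returns -{2}E t1 eqxx !andbT.
  + by move=> t1 t2; apply: trI t1 t2.
- move=> x; rewrite !inE mem_rcons inE => /predU1P[->|/subI]; first by rewrite eqxx orbT.
  by rewrite !inE => /orP[->|->]; rewrite ?orbT.
move=> w; rewrite mem_rcons !inE negb_or => /predU1P[->|ws /andP[_ wI]].
  by rewrite eqxx.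
have [a [b [aI bI ret la lb]]] := retI w ws wI.
by exists a, b; rewrite !inE aI bI !orbT.
Qed.

(** The exception for [m] left by the greedy choice is removed by
    [cycle_factor_bound]. *)
Lemma transitive_core m : (forall i, max_cover H i <= max_cover H m) ->
  exists I : {set T}, [/\ m \in I, transitive_classes I &
    forall w, w \notin I -> exists a b, [/\ a \in I, b \in I, returns w a b,
          #|H w| <= #|H a| & #|H w| <= #|H b|]].
Proof.
move=> m_max; pose r := (fun i j : T => #|H j| <= #|H i|).
have tot_r : total r by move=> i j; apply: leq_total.
have tr_r : transitive r by move=> i j l h1 h2; apply: leq_trans h1.
have [|I [mI trI _ retI]] := @greedy_transitive m (sort r (enum T)).
  by rewrite -sorted_pairwise // sort_sorted.
exists I; split=> // w wI; have [|a [b [aI bI ret la lb]]] := retI w _ wI.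
  by rewrite mem_sort mem_enum.
have lewm : (#|H m| <= #|H a|) -> (#|H m| <= #|H b|) -> #|H w| <= #|H m|.
  by case/and3P: ret => *; apply: (@cycle_factor_bound m w a b).
exists a, b; have [lewm'|ltmw] := leqP #|H w| #|H m|.
  by split=> //; [case/orP: la | case/orP: lb] => // /eqP->.
have lema : #|H m| <= #|H a| by case/orP: la => [/(leq_trans (ltnW ltmw))|/eqP->].
have lemb : #|H m| <= #|H b| by case/orP: lb => [/(leq_trans (ltnW ltmw))|/eqP->].
by have := lewm lema lemb; rewrite leqNgt ltmw.
Qed.

Lemma induced_arc (V : {set Q}) (x y : induced V) : darc (val x) (val y) = darc x y.
Proof. by []. Qed.

Lemma size_le_lambda_in (V : {set Q}) (p : seq Q) : sorted e p -> uniq p ->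
  (forall v, v \in p -> v \in V) -> size p <= lambda (induced V).
Proof.
move=> sp up pV; apply: (@size_le_lambda_emb (induced V) Q val val_inj (@induced_arc V)) => // v /pV vV.
by exists (exist _ v vV : induced V).
Qed.

Lemma lambda_path_in (V : {set Q}) : exists p : seq Q, [/\ sorted e p, uniq p,
  size p = lambda (induced V) & forall v, v \in p -> v \in V].
Proof.
have [p [sp up zp imp]] := @lambda_path_emb (induced V) Q val val_inj (@induced_arc V).
by exists p; split=> // v /imp [u ->]; apply: valP.
Qed.

(** A longest path of [V] absorbs [x] through a cycle over classes of [J]: these
    lie in [V] entirely and are at least as large as the class of [x], of which
    the path misses at least [x]. *)
Lemma lambda_grows (V : {set Q}) (J : {set T}) x :
  (forall w, w \notin J -> exists a b, [/\ a \in J, b \in J, returns w a b,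
          #|H w| <= #|H a| & #|H w| <= #|H b|]) ->
  (forall v : Q, tag v \in J -> v \in V) -> x \notin V ->
  lambda (induced V) < lambda (induced (x |: V)).
Proof.
move=> retJ JV xV; have [p [sp up zp pV]] := lambda_path_in V.
have [p0|p0] := eqVneq p [::].
  rewrite -zp p0 /=; apply: (@size_le_lambda_in _ [:: x]) => // v.
  by rewrite !inE => ->.
have xJ : tag x \notin J by apply: contra xV; apply: JV.
have [a [b [aJ bJ /and3P[twa tab tbw] lea leb]]] := retJ _ xJ.
have psp := single_system p0 sp up.
pose n := #|H (tag x)|.
have clsA i : all (fun v => cls v == i) (take n (factor_seq i)).
  by apply/allP => v /mem_take; rewrite mem_factor_seq.
have uA i : uniq (take n (factor_seq i)) by rewrite take_uniq ?uniq_factor_seq.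
have sA i : n <= #|H i| -> size (take n (factor_seq i)) = n.
  by move=> lei; rewrite size_takel // size_factor_seq.
have [|||R' [psR' sub1 sub2]] := absorb (darc_irr (d := T)) T_semi comp_arc_between comp_arc_tag psp (erefl (cls x)) _ twa tbw tab
  (clsA a) (clsA b) (uA a) (uA b).
- by rewrite /= cats0; apply: contra xV; apply: pV.
- by rewrite !sA.
- rewrite sA //= cats0 -size_filter /n -size_factor_seq uniq_leq_size ?filter_uniq // => v.
  by rewrite mem_filter mem_factor_seq => /andP[].
have R'V v : v \in flatten R' -> v \in x |: V.
  move/sub2; rewrite (_ : flatten [:: p] = p) /= ?cats0 //.
  rewrite in_cons !mem_cat !inE => /or3P[->//|/pV->|/orP[]/mem_take]; rewrite ?orbT //;
    by rewrite mem_factor_seq => /eqP tv; rewrite JV ?orbT // tv.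
have ltp : size p < size (flatten R').
  rewrite -[(size p).+1]/(size (x :: p)); apply: uniq_leq_size.
    by rewrite /= up andbT; apply: contra xV; apply: pV.
  by move=> v vp; apply: sub1; rewrite /= cats0.
rewrite -zp (leq_trans ltp) //; case/and3P: psR' => sR' okR' uR' {sub1 sub2 ltp}.
case: R' sR' okR' uR' R'V => [|r [|//]] //= _; rewrite cats0 andbT => /andP[_ sr] ur rV.
exact: size_le_lambda_in.
Qed.

Lemma lambda_grows_to (V : {set Q}) (J : {set T}) :
  (forall w, w \notin J -> exists a b, [/\ a \in J, b \in J, returns w a b,
          #|H w| <= #|H a| & #|H w| <= #|H b|]) ->
  (forall v : Q, tag v \in J -> v \in V) ->
  lambda (induced V) + #|~: V| <= lambda Q.
Proof.
move=> retJ; move: {2}#|~: V| (leqnn #|~: V|) => n.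
elim: n V => [|n IH] V len JV.
  move: len; rewrite leqn0 => /eqP->; rewrite addn0.
  by have [p [sp up <- _]] := lambda_path_in V; apply: size_le_lambda.
have [V0|[x]] := set_0Vmem (~: V).
  by apply: IH => //; rewrite V0 cards0.
rewrite inE => xV; have := lambda_grows retJ JV xV.
have E : #|~: V| = (#|~: (x |: V)|).+1.
  by rewrite setCU -setDE setDE setIC -setDE (cardsD1 x (~: V)) inE xV.
rewrite E addnS -addSn => lt; apply: leq_trans (_ : lambda (induced (x |: V)) + #|~: (x |: V)| <= _).
  by rewrite leq_add2r.
apply: IH; first by rewrite -ltnS -E.
by move=> v vJ; rewrite inE JV ?orbT.
Qed.

(** In a transitive set of classes a path never comes back to a class that it has
    left. *)
Lemma sorted_class (I : {set T}) (p : seq Q) i : transitive_classes I ->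
  all (fun v => cls v \in I) p -> sorted e p -> sorted e [seq v <- p | cls v == i].
Proof.
move=> trI pI sp.
pose r (u v : Q) := (tag u == tag v) || t (tag u) (tag v).
have rtr : {in (fun v => cls v \in I) & &, transitive r}.
  move=> y x z yI xI zI; rewrite /r => /orP[/eqP->//|txy] /orP[/eqP<-|tyz].
    by rewrite txy orbT.
  have [//|nxz] := eqVneq (tag x) (tag z).
  have := T_semi nxz; case/orP=> [->//|tzx].
  by have := trI _ _ _ xI yI zI txy; rewrite tyz orbT tzx => /(_ isT).
have sr : pairwise r p.
  rewrite -(sorted_pairwise_in rtr) //; apply: sub_sorted sp => u v euv.
  rewrite /r; case: eqP => //= /eqP; exact: comp_arc_tag.
elim: p sp sr pI => //= v p IH sp /andP[rv rp] /andP[vI pI].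
have {}IH := IH (path_sorted sp) rp pI.
have [cv|//] := eqVneq (tag v) i.
case: p sp rv rp pI IH => [|y p] //= /andP[evy _] /andP[_ rv] /andP[ry _] /andP[yI _].
have [cy|cy] := eqVneq (tag y) i; first by move=> /= ->; rewrite andbT.
have tvy : t (tag v) (tag y) by apply: comp_arc_tag => //; rewrite cv eq_sym.
suff -> : [seq v <- p | tag v == i] = [::] by [].
apply/eqP; rewrite -[_ == _]negbK -has_filter; apply/hasPn => z /(allP ry).
rewrite /r; apply: contraTneq => ->; rewrite negb_or cy /= -cv.
by apply: (trI _ _ _ vI yI yI tvy); rewrite eqxx.
Qed.

Lemma size_classes (js : seq T) (p : seq Q) : uniq js ->
  all (fun v => cls v \in js) p ->
  size p = \sum_(j <- js) count (fun v => cls v == j) p.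
Proof.
move=> ujs; elim: p => [|v p IH] /=; first by rewrite big1_seq.
case/andP=> vjs /IH ->; rewrite big_split /= -add1n; congr addn.
by rewrite (bigD1_seq (tag v)) //= eqxx big1 // => j /negPf; rewrite eq_sym => ->.
Qed.

Lemma count_le_lambda (I : {set T}) (p : seq Q) i : transitive_classes I ->
  all (fun v => cls v \in I) p -> sorted e p -> uniq p ->
  count (fun v => cls v == i) p <= lambda (H i).
Proof.
move=> trI pI sp up; rewrite -size_filter; apply: size_le_lambda_factor.
- exact: sorted_class trI pI sp.
- exact: filter_uniq.
- exact: filter_all.
Qed.

Lemma size_le_sum_lambda (I : {set T}) (js : seq T) (p : seq Q) :
  transitive_classes I -> uniq js -> {subset js <= I} ->
  all (fun v => cls v \in js) p -> sorted e p -> uniq p ->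
  size p <= \sum_(j <- js) lambda (H j).
Proof.
move=> trI ujs subI pjs sp up; rewrite (size_classes ujs pjs).
apply: leq_sum => j _; apply: (count_le_lambda _ trI) => //.
by apply: sub_all pjs => v /subI.
Qed.

(** Reduces the conclusion to the extension of the path systems that avoid
    [A]. *)
Lemma partition_from_systems (A : {set Q}) q : lambda (induced A) <= q ->
  (forall k R, systems k.+1 R -> all (fun v => v \notin A) (flatten R) ->
     exists2 R', systems k.+1 R' & size (flatten R) + q <= size (flatten R')) ->
  exists A B : {set Q}, [/\ is_partition A B, lambda (induced A) <= q
    & forall k, 1 <= k <= #|B| -> lambda_k k (induced B) + q <= lambda_k k Q].
Proof.
move=> leA ext; exists A, (~: A); split=> //.
  by split; [rewrite disjoints_subset setCK | rewrite setUCr].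
case=> // k /andP[_ lek].
have lek' : k.+1 <= #|induced (~: A)| by rewrite /= card_sig; apply: leq_trans lek _; apply: subset_leq_card; apply/subsetP.
have [R [psR sR <- imR]] := @lambda_k_paths_emb (induced (~: A)) Q val val_inj (@induced_arc (~: A)) _ lek'.
have [|R' psR' leR'] := ext k R psR.
  by apply/allP => v /imR [u ->]; have := valP u; rewrite inE.
apply: leq_trans (leR') _; apply: size_le_lambda_k => //.
apply: leq_trans (leq_trans (leq_addr q _) leR'); rewrite -{1}sR.
by case/and3P: psR => _ okR _; apply: leq_size_flatten; apply: sub_all okR => r /andP[].
Qed.

(** The runs of [R] in [H m] form an [s]-path subdigraph of [B0].  They are
    replaced by an [s]-path subdigraph of [H m] of maximum order, which by
    hypothesis has at least [q] more vertices; if [R] avoids [H m], a longest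
    path of [H m] is inserted instead. *)
Lemma system_BNY_step m q (A0 B0 : {set H m}) k R :
  0 < q < lambda (H m) -> is_partition A0 B0 ->
  (forall s, 1 <= s <= #|B0| -> lambda_k s (induced B0) + q <= lambda_k s (H m)) ->
  systems k.+1 R -> (forall x, factor_elt x \in flatten R -> x \notin A0) ->
  exists2 R', systems k.+1 R' & size (flatten R) + q <= size (flatten R').
Proof.
move=> /andP[q0 ltq] [disj cover] bny psR RA.
have /and3P[_ _ uR] := psR.
have [s [U [rU pU s0 sU swap]]] := resegment T_semi comp_arc_between comp_arc_tag m psR.
have sizeR : size (flatten R) = size [seq v <- flatten R | cls v != m] + size (flatten U).
  rewrite (perm_size pU) !size_filter addnC.
  by rewrite -(count_predC (fun v => cls v == m)).
suff [U' [sU' rU' uU' leU']] : exists U', [/\ size U' = s, all (run e cls m) U',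
    uniq (flatten U') & size (flatten U) + q <= size (flatten U')].
  have [R' psR' pR'] := swap U' sU' rU' uU'; exists R' => //.
  by rewrite (perm_size pR') size_cat sizeR -addnA leq_add2l.
case: sU => [sU|[U0 s1]]; last first.
  have [p [sp up zp cp]] := factor_path m.
  exists [:: p]; rewrite s1 U0 /= cats0 up zp; split=> //; last exact: ltnW.
  by rewrite /run sp cp -size_eq0 zp -lt0n lambda_factor_gt0.
have psU : systems s U.
  apply/and3P; rewrite sU leqnn (perm_uniq pU) filter_uniq //; split=> //.
  by apply: sub_all rU => u /and3P[-> ->].
have lesU : s <= size (flatten U) by rewrite -sU; apply: leq_size_runs rU.
pose f (x : induced B0) : Q := factor_elt (val x).
have f_inj : injective f by move=> x y /factor_elt_inj /val_inj.
have f_arc x y : darc (f x) (f y) = darc x y by apply: factor_elt_arc.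
have imU v : v \in flatten U -> exists x : induced B0, v = f x.
  move=> vU; have [x Ev] := factor_eltP (runs_class rU vU).
  have xB : x \in B0.
    have : x \in A0 :|: B0 by rewrite cover inE.
    have xR : factor_elt x \in flatten R.
      by rewrite -Ev; move: vU; rewrite (perm_mem pU) mem_filter => /andP[].
    by rewrite inE (negPf (RA x xR)).
  by exists (exist _ x xB : induced B0).
have leUB : size (flatten U) <= lambda_k s (induced B0).
  exact: (size_le_lambda_k_emb f_inj f_arc psU lesU imU).
have lesB : s <= #|B0|.
  have [W EW] := lift_to_image imU.
  apply: leq_trans lesU _; rewrite EW size_map.
  have uW : uniq W by rewrite -(map_inj_uniq f_inj) -EW; case/and3P: psU.
  have := max_card (mem W); rewrite (card_uniqP uW) => leW; apply: leq_trans leW _.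
  by rewrite /= card_sig; apply: subset_leq_card; apply/subsetP.
have lesH : s <= #|H m| by apply: leq_trans lesB (max_card _).
have [U' [/and3P[_ /allP okU' uU'] sU' zU' imU']] :=
  lambda_k_paths_emb (@factor_elt_inj m) (@factor_elt_arc m) lesH.
exists U'; split=> //.
  apply/allP => u uU; have /andP[u0 su] := okU' u uU.
  rewrite /run u0 su /=; apply/allP => v vu.
  by have [|x ->] := imU' v; [apply/flattenP; exists u | rewrite /= eqxx].
by rewrite zU'; apply: leq_trans (bny s _); rewrite ?leq_add2r // s0 lesB.
Qed.

Lemma system_class_step m k R : systems k.+1 R ->
  all (fun v => cls v != m) (flatten R) ->
  exists2 R', systems k.+1 R' & size (flatten R) + max_cover H m <= size (flatten R').
Proof.
move=> psR offR; have [p lp <-] := max_cover_attained m m.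
have psp : systems 1 [:: p] by have p0 := longest_neq0 lp m; case: lp => *; apply: single_system.
have [R' psR' sub] := absorb_class (darc_irr (d := T)) T_semi comp_arc_between comp_arc_tag psR psp offR.
exists R' => //; rewrite -size_filter -size_cat; apply: uniq_leq_size => //.
have /and3P[_ _ uR] := psR; have [_ up _] := lp.
rewrite cat_uniq uR filter_uniq // andbT; apply/hasPn => v; rewrite mem_filter => /andP[vm _].
by apply/negP => /(allP offR); rewrite vm.
Qed.

End Composition.

(** * The partition *)

Theorem theorem7 (T : digraph) (H : T -> digraph)
    (T_semicomplete : semicomplete T)
    (H_nonempty : forall i : T, 0 < #|H i|)
    (m : T) (m_max : max_cover H m = \max_(i : T) max_cover H i)
    (Hm_BNY : BNY (H m)) :
  BNY (composition H).
Proof.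
pose Q := composition H; pose e := @darc Q.
have mc_le i : max_cover H i <= max_cover H m by rewrite m_max leq_bigmax.
have [I [mI trI retI]] := transitive_core T_semicomplete H_nonempty mc_le.
move=> q /andP[q0 ltq].
have ltqQ : q < lambda Q by move: ltq; rewrite -/Q; lia.
pose lam i := lambda (H i).
have lamI : forall (J : {set T}) (p : seq Q), J \subset I -> all (fun v => tag v \in J) p ->
    sorted e p -> uniq p -> size p <= \sum_(j in J) lam j.
  move=> J p /subsetP JI pJ sp up; rewrite -big_enum /=.
  apply: (size_le_sum_lambda T_semicomplete trI (enum_uniq J)) => //.
    by move=> j; rewrite mem_enum; apply: JI.
  by apply: sub_all pJ => v; rewrite mem_enum.
have [leIq|ltqI] := leqP (\sum_(i in I) lam i) q.
  pose P (A : {set Q}) := lambda (induced A) <= q.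
  have P0 : P [set v : Q | tag v \in I].
    have [p [sp up zp pI]] := lambda_path_in [set v : Q | tag v \in I].
    rewrite /P -zp; apply: leq_trans leIq; apply: lamI => //; apply/allP => v /pI.
    by rewrite inE.
  have [A /maxsetP[PA maxA] IA] := maxset_exists P0.
  have IA' v : tag v \in I -> v \in A by move=> vI; apply: (subsetP IA); rewrite inE.
  apply: (partition_from_systems PA) => k R psR RA.
  have leRB : size (flatten R) <= #|~: A|.
    have /and3P[_ _ uR] := psR; rewrite -(card_uniqP uR); apply: subset_leq_card.
    by apply/subsetP => v /(allP RA); rewrite inE.
  have [p [sp up zp]] := lambda_path Q.
  have [/allP pA|/allPn[y _ yA]] := boolP (all (fun v => v \in A) p).
    by have := leq_trans (size_le_lambda_in sp up pA) PA; rewrite zp leqNgt ltqQ.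
  have p0 : p != [::] by rewrite -size_eq0 zp -lt0n; apply: leq_trans ltqQ.
  exists [:: p]; first by rewrite /path_system /= cats0 p0 sp up.
  rewrite /= cats0 zp.
  have lt1 : q < lambda (induced (y |: A)).
    rewrite ltnNge; apply/negP => le; have := maxA _ le (subsetUr _ _).
    by move/setP/(_ y); rewrite !inE eqxx (negPf yA).
  (* A single vertex y pushes the longest path above q; each remaining vertex of
     the complement then adds at least one more. *)
  have grow : lambda (induced (y |: A)) + #|~: (y |: A)| <= lambda Q.
    apply: (lambda_grows_to T_semicomplete retI) => v vI.
    by rewrite inE IA' ?orbT.
  have E : #|~: A| = #|~: (y |: A)|.+1.
    by rewrite setCU -setDE setDE setIC -setDE (cardsD1 y (~: A)) inE yA.
  apply: leq_trans grow; rewrite addnC; apply: leq_trans (leq_add (leqnn q) leRB) _.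
  by rewrite E addnS -addSn leq_add2r.
pose lJ (J : {set T}) := \sum_(j in J) lam j.
pose PJ (J : {set T}) := (J \subset I :\ m) && (lJ J <= q).
have PJ0 : PJ set0 by rewrite /PJ sub0set /lJ big_set0.
have [J /maxsetP[/andP[JI leJ] maxJ] _] := maxset_exists PJ0.
have mJ : m \notin J by apply/negP => /(subsetP JI); rewrite !inE eqxx.
have JI' : J \subset I by apply: subset_trans JI (subsetDl _ _).
(* Adding one more index j to J would exceed q, by maximality; if none is left,
   q is below the whole sum over I.  Both lambda j and lambda m are at most l_m. *)
have ltJ : q < lJ J + max_cover H m.
  have lelam i : lam i <= max_cover H m.
    by apply: leq_trans (lambda_factor_le_max_cover T_semicomplete H_nonempty i) (mc_le i).
  have [EJ|/subsetPn[j jI jJ]] := boolP (I :\ m \subset J).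
    have {}EJ : J = I :\ m by apply/eqP; rewrite eqEsubset JI.
    apply: leq_trans ltqI _; rewrite (big_setD1 m) //= addnC -EJ.
    by rewrite leq_add2l.
  rewrite ltnNge; apply/negP => le; have Pj : PJ (j |: J).
    rewrite /PJ subUset sub1set jI JI /= /lJ big_setU1 //= addnC.
    by apply: leq_trans le; rewrite leq_add2l.
  by have := maxJ _ Pj (subsetUr _ _) => /setP/(_ j); rewrite !inE eqxx (negPf jJ).
have insJ k R : path_system e k.+1 R -> all (fun v => tag v \notin J) (flatten R) ->
   exists R', [/\ path_system e k.+1 R', size (flatten R') = size (flatten R) + lJ J &
     forall v, v \in flatten R' -> tag v \in J \/ v \in flatten R].
  move=> psR RJ; have [|R' [psR' sR' memR']] :=
    insert_factors T_semicomplete H_nonempty psR (enum_uniq J).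
    by apply: sub_all RJ => v; rewrite mem_enum.
  exists R'; split=> //; first by rewrite sR' /lJ -big_enum.
  by move=> v /memR'; rewrite mem_enum.
have [q' Eq] : exists q', q = lJ J + q' by exists (q - lJ J); lia.
have ltq' : q' < max_cover H m by rewrite Eq ltn_add2l in ltJ.
have [lelq|ltql] := leqP (lam m) q'.
  apply: (@partition_from_systems _ _ [set v : Q | tag v \in m |: J]).
    have [p [sp up <- pA]] := lambda_path_in [set v : Q | tag v \in m |: J].
    apply: leq_trans (lamI (m |: J) p _ _ sp up) _.
    - by rewrite subUset sub1set mI JI'.
    - by apply/allP => v /pA; rewrite inE.
    - by rewrite big_setU1 //= Eq addnC leq_add2l.
  move=> k R psR RA.
  have [|R1 [psR1 sR1 memR1]] := insJ k R psR.
    by apply: sub_all RA => v; rewrite !inE negb_or => /andP[].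
  have [|R2 psR2 leR2] := system_class_step T_semicomplete H_nonempty psR1 (m := m).
    apply/allP => v /memR1 [vJ|/(allP RA)]; first by apply: contraNneq mJ => <-.
    by rewrite !inE negb_or => /andP[].
  exists R2 => //; apply: leq_trans leR2; rewrite sR1 Eq addnA leq_add2l.
  exact: ltnW.
(* For q' = 0 the empty set serves as the part of H m in A. *)
have [A0 [B0 [parAB leA0 bny]]] : exists A0 B0 : {set H m},
    [/\ is_partition A0 B0, lambda (induced A0) <= q' &
      0 < q' -> forall s, 1 <= s <= #|B0| -> lambda_k s (induced B0) + q' <= lambda_k s (H m)].
  have [q'0|q'0] := posnP q'.
    exists set0, setT; split=> //.
      by split; [rewrite disjoints_subset sub0set | rewrite set0U].
    have [[|x p] [_ _ <-]] := lambda_path (induced (set0 : {set H m})) => //.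
    by have := valP x; rewrite inE.
  have [|A0 [B0 [? ? ?]]] := Hm_BNY q'; last by exists A0, B0; split.
  by rewrite q'0; move: ltql; rewrite /lam; lia.
pose A : {set Q} := [set v : Q | tag v \in J] :|: [set factor_elt x | x in A0].
apply: (@partition_from_systems _ _ A).
  have [p [sp up <- pA]] := lambda_path_in A.
  have pmJ : all (fun v => tag v \in m :: enum J) p.
    apply/allP => v /pA; rewrite !inE mem_enum => /orP[->|/imsetP[x _ ->]]; first by rewrite orbT.
    by rewrite eqxx.
  have pI : all (fun v => tag v \in I) p.
    apply: sub_all pmJ => v; rewrite inE mem_enum => /predU1P[->//|].
    exact: (subsetP JI').
  have umJ : uniq (m :: enum J) by rewrite /= mem_enum mJ enum_uniq.
  rewrite (size_classes umJ pmJ) big_cons Eq addnC; apply: leq_add.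
    rewrite big_enum /=; apply: leq_sum => j _.
    exact: (count_le_lambda T_semicomplete j trI pI sp up).
  apply: leq_trans leA0; rewrite -size_filter.
  pose f (x : induced A0) : Q := factor_elt (val x).
  have f_inj : injective f by move=> x y /factor_elt_inj /val_inj.
  have f_arc x y : darc (f x) (f y) = darc x y by apply: factor_elt_arc.
  apply: (size_le_lambda_emb f_inj f_arc); rewrite ?filter_uniq //.
    exact: (sorted_class T_semicomplete _ trI pI sp).
  move=> v; rewrite mem_filter => /andP[/eqP vm /pA]; rewrite !inE vm (negPf mJ) /=.
  by case/imsetP => x xA0 ->; exists (exist _ x xA0 : induced A0).
move=> k R psR RA.
have [|R1 [psR1 sR1 memR1]] := insJ k R psR.
  by apply: sub_all RA => v; rewrite !inE negb_or => /andP[].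
have [q'0|q'0] := posnP q'.
  by exists R1 => //; rewrite sR1 Eq q'0 addn0.
have [||R2 psR2 leR2] := system_BNY_step T_semicomplete H_nonempty _ parAB (bny q'0) psR1.
- by rewrite q'0.
- move=> x /memR1 [xJ|/(allP RA)]; first by rewrite /= (negPf mJ) in xJ.
  by rewrite !inE negb_or => /andP[_]; apply: contra => xA; apply/imsetP; exists x.
by exists R2 => //; apply: leq_trans leR2; rewrite sR1 Eq addnA.
Qed.
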